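(* Let $H$ be a Hopf algebra over a field $\Bbbk$ with bijective antipode and let $(A,\rho_A)$ be a right $H$-comodule algebra. The map $\Phi$, which sends a Casimir morphism $B$ for $(H,\psi)$ to the integral $\Phi(B):h\mapsto B(h\otimes 1_H)$ on $(H,\psi)$, induces a bijective correspondence between the set $\mathrm{Casim^h_{norm}}(H,\psi)$ of normalized Casimir morphisms for $(H,\psi)$ satisfying the h-coseparability condition and the set $\int^{\mathrm{h\text{-}tot}}_{(H,\psi)}$ of total integrals on $(H,\psi)$ satisfying the h-property.
   Context: Everything is over a field $\Bbbk$, $\otimes=\otimes_{\Bbbk}$, and Sweedler notation with suppressed summation is used. $H$ is a Hopf algebra with counit $\varepsilon$ and antipode $S$; $H^{\mathrm{op}}$ is $H$ with opposite multiplication. A right $H$-comodule algebra $(A,\rho_A)$ is a unital associative algebra $A$ which is a right $H$-comodule via an algebra map $\rho_A:A\to A\otimes H$, $\rho_A(a)=a_0\otimes a_1$ (iterated: $a_0\otimes a_1\otimes a_2$, etc.). With $\psi:H\otimes A\otimes H^{\mathrm{op}}\to A\otimes H^{\mathrm{op}}\otimes H$, $\psi(h\otimes a\otimes l)=a_0\otimes l_1\otimes l_2ha_1$, one has a cowreath $(A\otimes H^{\mathrm{op}},H,\psi)$. Convention: whenever a multiplication symbol is omitted, products in $A\otimes H$ are computed with the ordinary multiplications of $A$ and of $H$ (not the opposite one). A Casimir morphism for $(H,\psi)$ is a $\Bbbk$-linear map $B:H\otimes H\to A\otimes H^{\mathrm{op}}$, written $B(h\otimes h')=B^A(h\otimes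 h')\otimes B^H(h\otimes h')$, such that for all $a\in A$, $g,h,h'\in H$: $$(a_0\otimes 1_H)B(g_2ha_1\otimes g_3h'a_2)(1_A\otimes g_1)=(1_A\otimes g)B(h\otimes h')(a\otimes 1_H),$$ $$B^A(h_2\otimes h')_0\otimes B^H(h_2\otimes h')_1\otimes B^H(h_2\otimes h')_2h_1B^A(h_2\otimes h')_1=B(h\otimes h'_1)\otimes h'_2.$$ It is normalized if $B(h_1\otimes h_2)=\varepsilon(h)1_A\otimes 1_H$ for all $h\in H$. It satisfies the h-coseparability condition if for all $h,h',h''\in H$ $$B^A(h\otimes h'_1)B^A(h'_2\otimes h'')\otimes B^H(h'_2\otimes h'')B^H(h\otimes h'_1)=\varepsilon(h')B(h\otimes h'').$$ An integral on $(H,\psi)$ is a $\Bbbk$-linear map $\mathfrak{T}:H\to A\otimes H^{\mathrm{op}}$, written $\mathfrak{T}(h)=\mathfrak{T}^A(h)\otimes \mathfrak{T}^H(h)$, such that for all $a\in A$, $h\in H$: $$\mathfrak{T}^A(h_2)_0\otimes \mathfrak{T}^H(h_2)_1\otimes \mathfrak{T}^H(h_2)_2h_1\mathfrak{T}^A(h_2)_1=\mathfrak{T}(h)\otimes 1_H,$$ $$(a_0\otimes 1_H)\mathfrak{T}(S^{-1}(a_2)ha_1)(1_A\otimes S^{-1}(a_3))=(1_A\otimes S^{-1}(a_1))\mathfrak{T}(h)(a_0\otimes 1_H).$$ It is total if $\mathfrak{T}(1_H)=1_A\otimes 1_H$. A total integral satisfies the h-property if $(\mathrm{Id}_A\otimes\varepsilon)(\mathfrak{T}(h)\mathfrak{T}(h'))=(\mathrm{Id}_A\otimes\varepsilon)(\mathfrak{T}(h'h))$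 for all $h,h'\in H$, i.e. $(\mathrm{Id}_A\otimes \varepsilon)\mathfrak{T}:H\to A$ is an anti-homomorphism of algebras. *)

(* Defs.v *)
From HB Require Import structures.
From mathcomp Require Import all_boot all_order all_algebra.
From mathcomp Require Import generic_quotient.
From mathcomp Require Import boolp classical_sets functions.

Set Implicit Arguments.
Unset Strict Implicit.
Unset Printing Implicit Defensive.

Import GRing.Theory.
Local Open Scope ring_scope.
Local Open Scope quotient_scope.

Reserved Notation "V ⊗ W" (at level 45, left associativity).
Reserved Notation "\tsum_ ( x ⊗ y <- t ) F"
  (at level 41, x name, y name, t at level 60, F at level 45,
   format "'[' \tsum_ ( x  ⊗  y  <-  t ) '/  '  F ']'").

(* The tensor product of two k-vector spaces is the set of formal sums of     *)
(* pairs, modulo the congruence generated by the bilinearity relations.       *)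
Section Tensor.
Variables (k : fieldType) (V W : lmodType k).

Inductive tens_eq : seq (V * W) -> seq (V * W) -> Prop :=
| TensRefl s : tens_eq s s
| TensSym s t : tens_eq s t -> tens_eq t s
| TensTrans s t u : tens_eq s t -> tens_eq t u -> tens_eq s u
| TensCat s t u : tens_eq s t -> tens_eq (s ++ u) (t ++ u)
| TensCatC s t : tens_eq (s ++ t) (t ++ s)
| Tens0 w : tens_eq [:: (0, w)] [::]
| TensDl v v' w : tens_eq [:: (v + v', w)] [:: (v, w); (v', w)]
| TensDr v w w' : tens_eq [:: (v, w + w')] [:: (v, w); (v, w')]
| TensZ a v w : tens_eq [:: (a *: v, w)] [:: (v, a *: w)].

Definition tens_eqb (s t : seq (V * W)) : bool := `[< tens_eq s t >].

Lemma tens_eqb_refl : reflexive tens_eqb.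
Proof. by move=> s; apply/asboolP/TensRefl. Qed.
Lemma tens_eqb_sym : symmetric tens_eqb.
Proof. by move=> s t; apply/asboolP/asboolP; apply: TensSym. Qed.
Lemma tens_eqb_trans : transitive tens_eqb.
Proof.
by move=> t s u /asboolP st /asboolP tu; apply/asboolP; apply: TensTrans st tu.
Qed.

Canonical tens_equiv :=
  EquivRel tens_eqb tens_eqb_refl tens_eqb_sym tens_eqb_trans.

Definition tensor : Type := {eq_quot tens_equiv}.

HB.instance Definition _ := Choice.on tensor.
HB.instance Definition _ := EqQuotient.on tensor.

Definition tens (v : V) (w : W) : tensor := \pi_tensor [:: (v, w)].

(* If [f] is bilinear, [t |-> tsum t f] is the linear map that sends          *)
(* [tens v w] to [f v w]; see [tsum_tens] and [tsum_is_linear] below.         *)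
Definition tsum (t : tensor) (U : lmodType k) (f : V -> W -> U) : U :=
  \sum_(p <- repr t) f p.1 p.2.

Lemma tens_eqP s t :
  reflect (tens_eq s t) (\pi_tensor s == \pi_tensor t).
Proof. by rewrite eqmodE; apply: asboolP. Qed.

Lemma pi_tens_eq s t : tens_eq s t -> \pi_tensor s = \pi_tensor t.
Proof. by move=> st; apply/eqP/tens_eqP. Qed.

Lemma tens_eq_repr s : tens_eq (repr (\pi_tensor s)) s.
Proof. by apply/tens_eqP; rewrite reprK. Qed.

Lemma tens_eq_cat s s' t t' :
  tens_eq s s' -> tens_eq t t' -> tens_eq (s ++ t) (s' ++ t').
Proof.
move=> ss tt; apply: TensTrans (TensCat t ss) _.
apply: TensTrans (TensCatC _ _) _; apply: TensTrans (TensCat _ tt) _.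
exact: TensCatC.
Qed.

Lemma tens_eq_map (f : V -> V) : (forall a, {morph f : v / a *: v}) ->
  {morph f : v v' / v + v'} -> forall s t, tens_eq s t ->
  tens_eq [seq (f p.1, p.2) | p <- s] [seq (f p.1, p.2) | p <- t].
Proof.
move=> fZ fD s t; elim=> {s t} /=.
- by move=> s; apply: TensRefl.
- by move=> s t _; apply: TensSym.
- by move=> s t u _ st _; apply: TensTrans.
- by move=> s t u _ st; rewrite !map_cat; apply: TensCat.
- by move=> s t; rewrite !map_cat; apply: TensCatC.
- by move=> w; rewrite -(scale0r 0) fZ scale0r; apply: Tens0.
- by move=> v v' w; rewrite fD; apply: TensDl.
- by move=> v w w'; apply: TensDr.
- by move=> a v w; rewrite fZ; apply: TensZ.
Qed.

Let scalemap (a : k) (s : seq (V * W)) := [seq (a *: p.1, p.2) | p <- s].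

Let scalemap_eq a s t : tens_eq s t -> tens_eq (scalemap a s) (scalemap a t).
Proof.
apply: (@tens_eq_map ( *:%R a)) => [b v|v v']; last exact: scalerDr.
by rewrite !scalerA mulrC.
Qed.

Lemma tensW (P : tensor -> Prop) :
  (forall s, P (\pi_tensor s)) -> forall t, P t.
Proof. by move=> Ppi t; rewrite -[t]reprK. Qed.

Definition tens_zero : tensor := \pi_tensor [::].
Definition tens_add (s t : tensor) : tensor := \pi_tensor (repr s ++ repr t).
Definition tens_scale (a : k) (t : tensor) : tensor :=
  \pi_tensor (scalemap a (repr t)).
Definition tens_opp (t : tensor) : tensor := tens_scale (-1) t.

Lemma tens_addE s t :
  tens_add (\pi_tensor s) (\pi_tensor t) = \pi_tensor (s ++ t).
Proof. by apply: pi_tens_eq; apply: tens_eq_cat; apply: tens_eq_repr. Qed.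

Lemma tens_scaleE a s :
  tens_scale a (\pi_tensor s) = \pi_tensor (scalemap a s).
Proof. by apply: pi_tens_eq; apply: scalemap_eq; apply: tens_eq_repr. Qed.

Lemma tens_addA : associative tens_add.
Proof.
elim/tensW=> s; elim/tensW=> t; elim/tensW=> u.
by rewrite !tens_addE catA.
Qed.

Lemma tens_addC : commutative tens_add.
Proof.
elim/tensW=> s; elim/tensW=> t; rewrite !tens_addE.
by apply: pi_tens_eq; apply: TensCatC.
Qed.

Lemma tens_add0 : left_id tens_zero tens_add.
Proof. by elim/tensW=> s; rewrite tens_addE. Qed.

Lemma tens_scaleA a b t : tens_scale a (tens_scale b t) = tens_scale (a * b) t.
Proof.
elim/tensW: t => s; rewrite !tens_scaleE /scalemap -map_comp.
by congr (\pi_tensor _); apply: eq_map => p /=; rewrite scalerA.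
Qed.

Lemma tens_scale1 : left_id 1 tens_scale.
Proof.
elim/tensW=> s; rewrite tens_scaleE; congr (\pi_tensor _).
by rewrite /scalemap -[RHS]map_id; apply: eq_map => -[v w]; rewrite scale1r.
Qed.

Lemma tens_scaleDr : right_distributive tens_scale tens_add.
Proof.
move=> a; elim/tensW=> s; elim/tensW=> t.
by rewrite !(tens_addE, tens_scaleE) /scalemap map_cat.
Qed.

Lemma tens_scaleDl t : {morph tens_scale^~ t : a b / a + b >-> tens_add a b}.
Proof.
move=> a b /=; elim/tensW: t => s; rewrite !tens_scaleE tens_addE.
apply: pi_tens_eq; elim: s => [|[v w] s IHs] /=; first exact: TensRefl.
have := tens_eq_cat (TensDl (a *: v) (b *: v) w) IHs.
rewrite -scalerDl /= => h; apply: TensTrans h _ => /=.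
apply: (@tens_eq_cat [:: _] [:: _]); first exact: TensRefl.
have := TensCat (scalemap b s) (TensCatC [:: (b *: v, w)] (scalemap a s)).
by rewrite -!catA.
Qed.

Lemma tens_scale0 t : tens_scale 0 t = tens_zero.
Proof.
elim/tensW: t => s; rewrite tens_scaleE; apply: pi_tens_eq.
elim: s => [|[v w] s IHs] /=; first exact: TensRefl.
by rewrite scale0r; apply: (@tens_eq_cat [:: _] [::] _ [::]); first exact: Tens0.
Qed.

Lemma tens_addN : left_inverse tens_zero tens_opp tens_add.
Proof.
move=> t; rewrite -{2}(tens_scale1 t) /tens_opp.
by rewrite -(tens_scaleDl t (-1) 1) addNr tens_scale0.
Qed.

HB.instance Definition _ :=
  GRing.isZmodule.Build tensor tens_addA tens_addC tens_add0 tens_addN.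
HB.instance Definition _ := GRing.Zmodule_isLmodule.Build k tensor
  tens_scaleA tens_scale1 tens_scaleDr tens_scaleDl.

Lemma tensDl v v' w : tens (v + v') w = tens v w + tens v' w.
Proof. by rewrite [RHS]tens_addE; apply: pi_tens_eq; apply: TensDl. Qed.

Lemma tensDr v w w' : tens v (w + w') = tens v w + tens v w'.
Proof. by rewrite [RHS]tens_addE; apply: pi_tens_eq; apply: TensDr. Qed.

Lemma tensZl a v w : tens (a *: v) w = a *: tens v w.
Proof. by rewrite [RHS]tens_scaleE. Qed.

Lemma tensZr a v w : tens v (a *: w) = a *: tens v w.
Proof. by rewrite -tensZl; apply: pi_tens_eq; apply/TensSym/TensZ. Qed.

Lemma tens_is_linear_l w : linear (tens^~ w).
Proof. by move=> a v v'; rewrite tensDl tensZl. Qed.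

Lemma tens_is_linear_r v : linear (tens v).
Proof. by move=> a w w'; rewrite tensDr tensZr. Qed.

Lemma pi_tensE s : \pi_tensor s = \sum_(p <- s) tens p.1 p.2.
Proof.
elim: s => [|[v w] s IHs]; first by rewrite big_nil.
by rewrite big_cons -IHs [RHS]tens_addE.
Qed.

Lemma tensE t : t = \sum_(p <- repr t) tens p.1 p.2.
Proof. by rewrite -pi_tensE reprK. Qed.

Definition bilin (U : lmodType k) (f : V -> W -> U) :=
  (forall w, linear (f^~ w)) /\ (forall v, linear (f v)).

Section Lift.
Variables (U : lmodType k) (f : V -> W -> U).
Hypothesis f_bilin : bilin f.

Let fDl w v v' : f (v + v') w = f v w + f v' w.
Proof. by have := f_bilin.1 w 1 v v'; rewrite !scale1r. Qed.
Let fDr v w w' : f v (w + w') = f v w + f v w'.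
Proof. by have := f_bilin.2 v 1 w w'; rewrite !scale1r. Qed.
Let f0l w : f 0 w = 0.
Proof. by apply: (addrI (f 0 w)); rewrite -fDl !addr0. Qed.
Let f0r v : f v 0 = 0.
Proof. by apply: (addrI (f v 0)); rewrite -fDr !addr0. Qed.
Let fZl a v w : f (a *: v) w = a *: f v w.
Proof. by have := f_bilin.1 w a v 0; rewrite /= !addr0 f0l addr0. Qed.
Let fZr a v w : f v (a *: w) = a *: f v w.
Proof. by have := f_bilin.2 v a w 0; rewrite !addr0 f0r addr0. Qed.

Let tens_eq_sum s t : tens_eq s t ->
  \sum_(p <- s) f p.1 p.2 = \sum_(p <- t) f p.1 p.2.
Proof.
elim=> {s t} //=.
- by move=> s t u _ -> _ ->.
- by move=> s t u _ st; rewrite !big_cat /= st.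
- by move=> s t; rewrite !big_cat /= addrC.
- by move=> w; rewrite big_seq1 big_nil f0l.
- by move=> v v' w; rewrite big_seq1 big_cons big_seq1 fDl.
- by move=> v w w'; rewrite big_seq1 big_cons big_seq1 fDr.
- by move=> a v w; rewrite !big_seq1 fZl fZr.
Qed.

Lemma tsum_pi s : tsum (\pi_tensor s) f = \sum_(p <- s) f p.1 p.2.
Proof. exact: tens_eq_sum (tens_eq_repr s). Qed.

Lemma tsum_tens v w : tsum (tens v w) f = f v w.
Proof. by rewrite tsum_pi big_seq1. Qed.

Lemma tsum_is_linear : linear (fun t => tsum t f).
Proof.
move=> a; elim/tensW=> s; elim/tensW=> t.
rewrite /=; have -> : a *: \pi_tensor s + \pi_tensor t = \pi_tensor (scalemap a s ++ t).
  by rewrite -[LHS]/(tens_add (tens_scale _ _) _) tens_scaleE tens_addE.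
rewrite !tsum_pi big_cat big_map scaler_sumr; congr (_ + _).
by apply: eq_bigr => p _; rewrite fZl.
Qed.

End Lift.

Lemma tens_bilin : bilin tens.
Proof. by split; [apply: tens_is_linear_l | apply: tens_is_linear_r]. Qed.

Lemma eq_linear_tens (U : lmodType k) (f g : {linear tensor -> U}) :
  (forall v w, f (tens v w) = g (tens v w)) -> f =1 g.
Proof.
by move=> fg t; rewrite (tensE t) !linear_sum; apply: eq_bigr => p _; apply: fg.
Qed.

End Tensor.

Notation "V ⊗ W" := (tensor V W) : type_scope.
Notation "v ⊗ w" := (tens v w) : ring_scope.

(* Sweedler-style notation: if [t] is the sum of the [x_i ⊗ y_i], this is the *)
(* sum of the [F x_i y_i], for an [F] which is bilinear in [x] and [y].       *)
Notation "\tsum_ ( x ⊗ y <- t ) F" := (tsum t (fun x y => F)) : ring_scope.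

Lemma eq_tsum (k : fieldType) (V W U : lmodType k) (f g : V -> W -> U) :
  f =2 g -> forall t, tsum t f = tsum t g.
Proof. by move=> fg t; apply: eq_bigr => p _; apply: fg. Qed.

(* Unital associative k-algebras. Unlike [algType k], this includes the zero  *)
(* algebra; the hierarchy of the library leaves no room for a structure that  *)
(* inherits from both [GRing.PzRing] and [GRing.Lmodule], so the ring         *)
(* structure is recovered by the canonical instances that follow.             *)
HB.mixin Record Lmodule_isUalgebra (k : fieldType) A of GRing.Lmodule k A := {
  uone : A;
  umul : A -> A -> A;
  umulA : associative umul;
  umul1l : left_id uone umul;
  umul1r : right_id uone umul;
  umulDl : left_distributive umul +%R;
  umulDr : right_distributive umul +%R;
  uscaleAl : forall (a : k) (x y : A), a *: umul x y = umul (a *: x) y;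
  uscaleAr : forall (a : k) (x y : A), a *: umul x y = umul x (a *: y)
}.

#[short(type="ualgType")]
HB.structure Definition Ualgebra (k : fieldType) :=
  {A of Lmodule_isUalgebra k A & GRing.Lmodule k A}.

HB.instance Definition _ (k : fieldType) (A : ualgType k) :=
  GRing.Zmodule_isPzRing.Build (Ualgebra.sort A)
    umulA umul1l umul1r umulDl umulDr.

Definition ualg_morph (k : fieldType) (A : ualgType k) (R : pzRingType)
  (f : A -> R) : Prop := monoid_morphism f.

Lemma ualg_scalerAl (k : fieldType) (A : ualgType k) (a : k) (x y : A) :
  a *: (x * y) = (a *: x) * y.
Proof. exact: uscaleAl. Qed.

Lemma ualg_scalerAr (k : fieldType) (A : ualgType k) (a : k) (x y : A) :
  a *: (x * y) = x * (a *: y).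
Proof. exact: uscaleAr. Qed.

Section TensorAlgebra.
Variables (k : fieldType) (A B : ualgType k).

Definition tens_one : A ⊗ B := (1 : A) ⊗ (1 : B).
Definition tens_mul (s t : A ⊗ B) : A ⊗ B :=
  \tsum_(a ⊗ x <- s) \tsum_(b ⊗ y <- t) (a * b) ⊗ (x * y).

Let inner_bilin (a : A) (x : B) :
  bilin (fun (b : A) (y : B) => (a * b) ⊗ (x * y)).
Proof.
split=> [y|b] c u v /=.
  by rewrite mulrDr -ualg_scalerAr tensDl tensZl.
by rewrite mulrDr -ualg_scalerAr tensDr tensZr.
Qed.

Let outer_bilin (t : A ⊗ B) :
  bilin (fun (a : A) (x : B) => \tsum_(b ⊗ y <- t) (a * b) ⊗ (x * y)).
Proof.
split=> [x|a] c u v; rewrite /tsum scaler_sumr -big_split;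
  apply: eq_bigr => p _ /=.
  by rewrite mulrDl -ualg_scalerAl tensDl tensZl.
by rewrite mulrDl -ualg_scalerAl tensDr tensZr.
Qed.

Lemma tens_mulE (a b : A) (x y : B) :
  tens_mul (a ⊗ x) (b ⊗ y) = (a * b) ⊗ (x * y).
Proof.
rewrite /tens_mul (tsum_tens (outer_bilin _)).
by rewrite (tsum_tens (inner_bilin _ _)).
Qed.

Lemma tens_mul_linear_l t : linear (tens_mul^~ t).
Proof. exact: tsum_is_linear (outer_bilin t). Qed.

Lemma tens_mul_linear_r s : linear (tens_mul s).
Proof.
move=> c u v; rewrite /tens_mul /tsum scaler_sumr -big_split.
by apply: eq_bigr => p _; apply: (tsum_is_linear (inner_bilin _ _)).
Qed.

Let mulDl : left_distributive tens_mul +%R.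
Proof. by move=> s t u; have := tens_mul_linear_l u 1 s t; rewrite !scale1r. Qed.
Let mulDr : right_distributive tens_mul +%R.
Proof. by move=> s t u; have := tens_mul_linear_r s 1 t u; rewrite !scale1r. Qed.
Let mul0l t : tens_mul 0 t = 0.
Proof. by apply: (addrI (tens_mul 0 t)); rewrite -mulDl !addr0. Qed.
Let mul0r t : tens_mul t 0 = 0.
Proof. by apply: (addrI (tens_mul t 0)); rewrite -mulDr !addr0. Qed.
Let mul_suml I (r : seq I) (F : I -> A ⊗ B) t :
  tens_mul (\sum_(i <- r) F i) t = \sum_(i <- r) tens_mul (F i) t.
Proof. by elim/big_rec2: _ => // i u v _ <-; rewrite mulDl. Qed.
Let mul_sumr I (r : seq I) (F : I -> A ⊗ B) t :
  tens_mul t (\sum_(i <- r) F i) = \sum_(i <- r) tens_mul t (F i).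
Proof. by elim/big_rec2: _ => // i u v _ <-; rewrite mulDr. Qed.

Let mulA : associative tens_mul.
Proof.
move=> s t u; rewrite (tensE s) !mul_suml; apply: eq_bigr => p _.
rewrite (tensE t) mul_suml !mul_sumr mul_suml; apply: eq_bigr => q _.
rewrite (tensE u) !mul_sumr; apply: eq_bigr => r _.
by rewrite !tens_mulE !mulrA.
Qed.
Let mul1l : left_id tens_one tens_mul.
Proof.
move=> s; rewrite {1}(tensE s) mul_sumr [RHS]tensE; apply: eq_bigr => p _.
by rewrite tens_mulE !mul1r.
Qed.
Let mul1r : right_id tens_one tens_mul.
Proof.
move=> s; rewrite {1}(tensE s) mul_suml [RHS]tensE; apply: eq_bigr => p _.
by rewrite tens_mulE !mulr1.
Qed.

Let scaleAl (a : k) x y : a *: tens_mul x y = tens_mul (a *: x) y.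
Proof.
by have := tens_mul_linear_l y a x 0; rewrite /= addr0 mul0l addr0 => <-.
Qed.
Let scaleAr (a : k) x y : a *: tens_mul x y = tens_mul x (a *: y).
Proof.
by have := tens_mul_linear_r x a y 0; rewrite /= addr0 mul0r addr0 => <-.
Qed.

HB.instance Definition _ := Lmodule_isUalgebra.Build k (A ⊗ B)%type
  mulA mul1l mul1r mulDl mulDr scaleAl scaleAr.
HB.instance Definition _ :=
  GRing.PzRing.copy (A ⊗ B)%type (Ualgebra.sort (A ⊗ B)%type).

Lemma tensM (a b : A) (x y : B) : (a ⊗ x) * (b ⊗ y) = (a * b) ⊗ (x * y).
Proof. exact: tens_mulE. Qed.

Lemma tens1 : (1 : A) ⊗ (1 : B) = 1.
Proof. by []. Qed.

End TensorAlgebra.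

HB.mixin Record Lmodule_isCoalgebra (k : fieldType) C of GRing.Lmodule k C := {
  comul : {linear C -> (C ⊗ C)%type};
  counit : {scalar C};
  comulA : forall c,
    \tsum_(c1 ⊗ c2 <- comul c) comul c1 ⊗ c2 =
    \tsum_(c1 ⊗ c' <- comul c) \tsum_(c2 ⊗ c3 <- comul c') (c1 ⊗ c2) ⊗ c3;
  counitl : forall c, \tsum_(c1 ⊗ c2 <- comul c) counit c1 *: c2 = c;
  counitr : forall c, \tsum_(c1 ⊗ c2 <- comul c) counit c2 *: c1 = c
}.

#[short(type="coalgType")]
HB.structure Definition Coalgebra (k : fieldType) :=
  {C of Lmodule_isCoalgebra k C & GRing.Lmodule k C}.

HB.mixin Record isBialgebra (k : fieldType) H
    of Ualgebra k H & Coalgebra k H := {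
  comul_monoid_morphism : ualg_morph (comul : H -> H ⊗ H);
  counit_monoid_morphism : ualg_morph (counit : H -> k)
}.

#[short(type="bialgType")]
HB.structure Definition Bialgebra (k : fieldType) :=
  {H of isBialgebra k H & Ualgebra k H & Coalgebra k H}.

HB.instance Definition _ (k : fieldType) (A : bialgType k) :=
  GRing.PzRing.copy (Bialgebra.sort A) (Ualgebra.sort A).

Definition is_antipode (k : fieldType) (H : bialgType k) (S : H -> H) : Prop :=
  forall h : H,
    \tsum_(h1 ⊗ h2 <- comul h) S h1 * h2 = counit h *: (1 : H) /\
    \tsum_(h1 ⊗ h2 <- comul h) h1 * S h2 = counit h *: (1 : H).

HB.mixin Record Bialgebra_isHopf (k : fieldType) H of Bialgebra k H := {
  antipode : {linear H -> H};
  antipodeP : is_antipode antipode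
}.

#[short(type="hopfAlgType")]
HB.structure Definition HopfAlgebra (k : fieldType) :=
  {H of Bialgebra_isHopf k H & Bialgebra k H}.

HB.instance Definition _ (k : fieldType) (A : hopfAlgType k) :=
  GRing.PzRing.copy (HopfAlgebra.sort A) (Ualgebra.sort A).

HB.mixin Record isComodAlgebra (k : fieldType) (H : hopfAlgType k) A
    of Ualgebra k A := {
  coact : {linear A -> (A ⊗ H)%type};
  coactA : forall a,
    \tsum_(a0 ⊗ a1 <- coact a) coact a0 ⊗ a1 =
    \tsum_(a0 ⊗ a' <- coact a) \tsum_(a1 ⊗ a2 <- comul a') (a0 ⊗ a1) ⊗ a2;
  coact_counit : forall a, \tsum_(a0 ⊗ a1 <- coact a) counit a1 *: a0 = a;
  coact_monoid_morphism : ualg_morph (coact : A -> A ⊗ H)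
}.

#[short(type="comodAlgType")]
HB.structure Definition ComodAlgebra (k : fieldType) (H : hopfAlgType k) :=
  {A of isComodAlgebra k H A & Ualgebra k A}.

HB.instance Definition _ (k : fieldType) (H : hopfAlgType k)
    (A : comodAlgType H) :=
  GRing.PzRing.copy (ComodAlgebra.sort A) (Ualgebra.sort A).

(* The inverse of the antipode; only meaningful when the latter is bijective. *)
Definition antipodeV (k : fieldType) (H : hopfAlgType k) (h : H) : H :=
  xget 0 [set g | antipode g = h].

Lemma antipodeK (k : fieldType) (H : hopfAlgType k) :
  bijective (antipode : H -> H) -> cancel antipode (@antipodeV k H).
Proof.
move=> bS h; apply: (bij_inj bS); rewrite /antipodeV.
by case: xgetP => [g _ ->|/(_ h)] //=.
Qed.

Lemma antipodeVK (k : fieldType) (H : hopfAlgType k) :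
  bijective (antipode : H -> H) -> cancel (@antipodeV k H) antipode.
Proof. by move=> bS; apply/(bij_can_sym bS)/antipodeK. Qed.

(* [A ⊗ H] stands for the vector space underlying the algebra A ⊗ H^op; its   *)
(* multiplication always comes from the ordinary multiplications of [A] and   *)
(* [H]. Iterated coactions and comultiplications are nested to the right.     *)
Section Casimir.
Variables (k : fieldType) (H : hopfAlgType k) (A : comodAlgType H).

Implicit Types (B : {linear (H ⊗ H)%type -> (A ⊗ H)%type})
  (T : {linear H -> (A ⊗ H)%type}).

Definition is_casimir B : Prop :=
  (forall (a : A) (g h h' : H),
     \tsum_(a0 ⊗ a' <- coact a) \tsum_(a1 ⊗ a2 <- comul a')
     \tsum_(g1 ⊗ g' <- comul g) \tsum_(g2 ⊗ g3 <- comul g')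
       (a0 ⊗ (1 : H)) * B ((g2 * h * a1) ⊗ (g3 * h' * a2)) * ((1 : A) ⊗ g1)
     = ((1 : A) ⊗ g) * B (h ⊗ h') * (a ⊗ (1 : H))) /\
  (forall h h' : H,
     \tsum_(h1 ⊗ h2 <- comul h) \tsum_(b ⊗ x <- B (h2 ⊗ h'))
     \tsum_(b0 ⊗ b1 <- coact b) \tsum_(x1 ⊗ x2 <- comul x)
       (b0 ⊗ x1) ⊗ (x2 * h1 * b1)
     = \tsum_(h'1 ⊗ h'2 <- comul h') B (h ⊗ h'1) ⊗ h'2).

Definition normalized_casimir B : Prop := forall h : H,
  \tsum_(h1 ⊗ h2 <- comul h) B (h1 ⊗ h2) = counit h *: ((1 : A) ⊗ (1 : H)).

Definition h_coseparable B : Prop := forall h h' h'' : H,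
  \tsum_(h'1 ⊗ h'2 <- comul h')
  \tsum_(b ⊗ x <- B (h ⊗ h'1)) \tsum_(c ⊗ y <- B (h'2 ⊗ h''))
    (b * c) ⊗ (y * x)
  = counit h' *: B (h ⊗ h'').

Definition is_integral T : Prop :=
  (forall h : H,
     \tsum_(h1 ⊗ h2 <- comul h) \tsum_(t ⊗ x <- T h2)
     \tsum_(t0 ⊗ t1 <- coact t) \tsum_(x1 ⊗ x2 <- comul x)
       (t0 ⊗ x1) ⊗ (x2 * h1 * t1)
     = T h ⊗ (1 : H)) /\
  (forall (a : A) (h : H),
     \tsum_(a0 ⊗ a' <- coact a)
     \tsum_(a1 ⊗ a'' <- comul a') \tsum_(a2 ⊗ a3 <- comul a'')
       (a0 ⊗ (1 : H)) * T (antipodeV a2 * h * a1) * ((1 : A) ⊗ antipodeV a3)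
     = \tsum_(a0 ⊗ a1 <- coact a) ((1 : A) ⊗ antipodeV a1) * T h * (a0 ⊗ (1 : H))).

Definition total_integral T : Prop := T 1 = (1 : A) ⊗ (1 : H).

Definition id_counit (t : A ⊗ H) : A := \tsum_(a ⊗ x <- t) counit x *: a.

Definition h_property T : Prop := forall h h' : H,
  id_counit (T h * T h') = id_counit (T (h' * h)).

Definition Casim_h_norm : set {linear (H ⊗ H)%type -> (A ⊗ H)%type} :=
  [set B | is_casimir B /\ normalized_casimir B /\ h_coseparable B].

Definition integral_h_tot : set {linear H -> (A ⊗ H)%type} :=
  [set T | is_integral T /\ total_integral T /\ h_property T].

Definition Phi_fun B (h : H) : A ⊗ H := B (h ⊗ (1 : H)).

Lemma Phi_is_linear B : linear (Phi_fun B).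
Proof. by move=> a g h; rewrite /Phi_fun tensDl tensZl linearP. Qed.

HB.instance Definition _ B :=
  GRing.isLinear.Build k H (A ⊗ H)%type _ (Phi_fun B) (@Phi_is_linear B).

Definition Phi B : {linear H -> (A ⊗ H)%type} := Phi_fun B.

End Casimir.

(* Main.v *)
(* The idea is to forget everything about an integral [T] but the map         *)
(* [t = (Id ⊗ ε) T : H -> A], and similarly for a Casimir morphism. With       *)
(* [twist z y x = z_0 ⊗ y S^-1(x z_1)], the first integral condition and the   *)
(* second Casimir condition give [T h = twist (t h_2) 1 h_1] and               *)
(* [B (h ⊗ p) = twist (t (S^-1(p_1) h_2)) p_2 h_1] with [t h] the value of     *)
(* [Id ⊗ ε] at [T h] and at [B (h ⊗ 1)] respectively. The latter formula shows *)
(* that [Phi] is injective. Conversely, it defines [B] from [T]; the remaining *)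
(* integral condition, [a_0 t(S^-1(a_2) h a_1) = t(h) a], gives the first      *)
(* Casimir condition, and the h-property is exactly what is needed to multiply *)
(* two values of [t] in the h-coseparability condition.                        *)
From HB Require Import structures.
Require Import Defs.
From mathcomp Require Import all_boot all_order all_algebra.
From mathcomp Require Import boolp classical_sets functions.

Set Implicit Arguments.
Unset Strict Implicit.
Unset Printing Implicit Defensive.

Import GRing.Theory.
Local Open Scope ring_scope.

(** Write [t] for [id_counit] after [Phi B], or after an integral [T]. Applying [id_counit] to the
    first tensor factor of the coaction condition on [B] or [T] leaves an equation where the unknown
    occurs only through [b_0 ⊗ v h b_1], and [cotwist_inv] solves it by means of [S^-1]. For an
    integral this is [integral_twist]. For a Casimir morphism, [casimir_counit] moves the second
    argument into the first, and [casimir_twist] then expresses [B] by [Phi B] alone, so [Phi] is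
    injective.

    For surjectivity, the same expression defines [B] from the [t] of a given [T]. The rules for
    [twist] reduce each requirement on [B] to cancelling products [S^-1(x_2) x_1] or
    [x_2 S^-1(x_1)]. The Casimir conditions follow with the help of [integral_coact], normalization
    comes from [t 1 = 1], and h-coseparability from the anti-multiplicativity of [t]. At second
    argument 1 the expression becomes that of [integral_twist], so [Phi B = T].

    That [Phi] takes values in the right set is [casimir_integral] together with
    [id_counit_Phi_antihom], which specializes h-coseparability and cancels an antipode. *)

Section Linearity.
Variable k : fieldType.
Implicit Types (U V W X : lmodType k) (R : ualgType k).

(** * Linearity of plain functions, and calculation with [tsum] *)

Definition lin U V (f : U -> V) : Prop :=
  forall a u v, f (a *: u + v) = a *: f u + f v.

Lemma linD U V (f : U -> V) : lin f -> {morph f : u v / u + v}.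
Proof. by move=> fL u v; have := fL 1 u v; rewrite !scale1r. Qed.

Lemma lin0 U V (f : U -> V) : lin f -> f 0 = 0.
Proof. by move=> fL; apply: (addrI (f 0)); rewrite -(linD fL) !addr0. Qed.

Lemma linZ U V (f : U -> V) : lin f -> forall a u, f (a *: u) = a *: f u.
Proof. by move=> fL a u; have := fL a u 0; rewrite (lin0 fL) !addr0. Qed.

Lemma lin_tsum U V W X (f : W -> X) (t : U ⊗ V) (F : U -> V -> W) :
  lin f -> f (tsum t F) = tsum t (fun x y => f (F x y)).
Proof.
by move=> fL; rewrite /tsum (big_morph f (linD fL) (lin0 fL)).
Qed.

Lemma lin_id U : lin (fun u : U => u).
Proof. by []. Qed.

Lemma lin_app U V W (f : {linear V -> W}) (g : U -> V) :
  lin g -> lin (fun u => f (g u)).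
Proof. by move=> gL a u v; rewrite gL linearP. Qed.

Lemma lin_fun U V W (f : V -> W) (g : U -> V) :
  lin f -> lin g -> lin (fun u => f (g u)).
Proof. by move=> fL gL a u v; rewrite gL fL. Qed.

Lemma lin_mull U R (f : U -> R) c : lin f -> lin (fun u => f u * c).
Proof. by move=> fL a u v; rewrite fL mulrDl ualg_scalerAl. Qed.

Lemma lin_mulr U R (f : U -> R) c : lin f -> lin (fun u => c * f u).
Proof. by move=> fL a u v; rewrite fL mulrDr ualg_scalerAr. Qed.

Lemma lin_scalel U V (f : U -> k^o) (c : V) :
  lin f -> lin (fun u => f u *: c).
Proof. by move=> fL a u v; rewrite fL scalerDl -scalerA. Qed.

Lemma lin_scaler U V (f : U -> V) (c : k) : lin f -> lin (fun u => c *: f u).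
Proof. by move=> fL a u v; rewrite fL scalerDr !scalerA mulrC. Qed.

Lemma lin_tensl U V W (f : U -> V) (w : W) : lin f -> lin (fun u => f u ⊗ w).
Proof. by move=> fL a u v; rewrite fL tensDl tensZl. Qed.

Lemma lin_tensr U V W (f : U -> V) (w : W) : lin f -> lin (fun u => w ⊗ f u).
Proof. by move=> fL a u v; rewrite fL tensDr tensZr. Qed.

Lemma lin_tsumr U V W X (t : V ⊗ W) (F : U -> V -> W -> X) :
  (forall v w, lin (fun u => F u v w)) -> lin (fun u => tsum t (F u)).
Proof.
move=> FL a u v; rewrite /tsum scaler_sumr -big_split.
by apply: eq_bigr => p _; exact: (FL p.1 p.2 a u v).
Qed.

Definition lin2 U V W (F : U -> V -> W) : Prop :=
  (forall v, lin (fun u => F u v)) /\ (forall u, lin (F u)).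

Definition lin3 U V W X (F : U -> V -> W -> X) : Prop :=
  [/\ forall v w, lin (fun u => F u v w), forall u w, lin (fun v => F u v w) &
      forall u v, lin (F u v)].

Lemma lin2_bilin U V W (F : U -> V -> W) : lin2 F -> bilin F.
Proof. by case=> Fl Fr; split=> ? a u v; [apply: Fl | apply: Fr]. Qed.

Lemma lin_tsuml U V W X (t : U -> V ⊗ W) (F : V -> W -> X) :
  lin2 F -> lin t -> lin (fun u => tsum (t u) F).
Proof.
move=> FL tL a u v; rewrite tL.
exact: (tsum_is_linear (lin2_bilin FL)).
Qed.

Lemma lin2_tens V W X (F : V -> W -> X) v w : lin2 F -> tsum (v ⊗ w) F = F v w.
Proof. by move=> FL; rewrite (tsum_tens (lin2_bilin FL)). Qed.

Lemma tsum_tensE V W (t : V ⊗ W) : t = tsum t (@tens k V W).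
Proof. exact: tensE. Qed.

Lemma tsum_tsum U V U' V' W (t : U ⊗ V) (G : U -> V -> U' ⊗ V')
  (F : U' -> V' -> W) : lin2 F ->
  tsum (tsum t G) F = tsum t (fun x y => tsum (G x y) F).
Proof.
by move=> FL; apply: (lin_tsum (f := fun s => tsum s F)); apply: lin_tsuml.
Qed.

Lemma exchange_tsum U V U' V' W (t : U ⊗ V) (s : U' ⊗ V')
  (F : U -> V -> U' -> V' -> W) :
  tsum t (fun x y => tsum s (F x y)) =
  tsum s (fun x' y' => tsum t (fun x y => F x y x' y')).
Proof. by rewrite /tsum exchange_big. Qed.

End Linearity.

Lemma lin_antipodeV (k : fieldType) (H : hopfAlgType k) (U : lmodType k)
  (f : U -> H) : bijective (antipode : H -> H) -> lin f ->
  lin (fun u => antipodeV (f u)).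
Proof.
move=> bijS fL a u v; rewrite fL; apply: (bij_inj bijS).
by rewrite linearP !antipodeVK.
Qed.

(* Redefined once there are further operations to recognize. *)
Ltac lin_hook := fail.

(* [apply:] eta-contracts, which hides the head symbol of the body. *)
Ltac lin_eta :=
  lazymatch goal with
  | |- lin (fun u => @?f u) => idtac
  | |- @lin ?k ?U ?V ?f => change (@lin k U V (fun u => f u))
  | |- _ => idtac
  end.

(** Since [tsum] sums over a chosen representative, a tensor may be replaced by another expression
    for it only under a bilinear summand, so such side conditions arise at almost every rewriting.
    The tactic follows the term, descending each time into the argument that contains the
    variable. *)
Ltac lin :=
  lin_eta;
  lazymatch goal with
  | |- lin2 _ => split; intro; cbv beta; lin
  | |- lin3 _ => split; intros ? ?; cbv beta; lin
  | |- forall _, _ => intro; cbv beta; lin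
  | |- lin (fun u => u) => exact: lin_id
  | |- lin (fun u => tens (@?f u) (@?g u)) =>
    lazymatch f with
    | fun _ => ?c => apply: lin_tensr
    | _ => apply: lin_tensl
    end; lin
  | |- lin (fun u => @GRing.mul _ (@?f u) (@?g u)) =>
    lazymatch f with
    | fun _ => ?c => apply: lin_mulr
    | _ => apply: lin_mull
    end; lin
  | |- lin (fun u => @GRing.scale _ _ (@?f u) (@?g u)) =>
    lazymatch f with
    | fun _ => ?c => apply: lin_scaler
    | _ => apply: lin_scalel
    end; lin
  | |- lin (fun u => tsum (@?t u) (@?F u)) =>
    lazymatch t with
    | fun _ => ?c => apply: lin_tsumr
    | _ => apply: lin_tsuml
    end; lin
  | |- lin (fun u => antipodeV (@?f u)) =>
    apply: lin_antipodeV; [assumption | lin]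
  | |- lin _ =>
    first [solve [auto] | exact: lin_id | lin_hook; lin | apply: lin_app; lin]
  | |- _ => assumption
  end.

(** * Coassociativity, counit and convolution in Sweedler form *)

Section Sweedler.
Variable (k : fieldType).

(** The linear map that [F] induces on [(C ⊗ C) ⊗ C] is applied to both sides of [comulA]. *)
Lemma comulA3 (C : coalgType k) (U : lmodType k) (F : C -> C -> C -> U)
    (c : C) :
  lin3 F ->
  \tsum_(x ⊗ c3 <- comul c) \tsum_(c1 ⊗ c2 <- comul x) F c1 c2 c3 =
  \tsum_(c1 ⊗ x <- comul c) \tsum_(c2 ⊗ c3 <- comul x) F c1 c2 c3.
Proof.
case=> F1 F2 F3.
pose G (u : C ⊗ C) (c3 : C) := tsum u (fun c1 c2 => F c1 c2 c3).
have GL : lin2 G by rewrite /G; lin.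
have /(congr1 (fun t => tsum t G)) := comulA c.
rewrite !tsum_tsum //.
under eq_tsum do rewrite lin2_tens //.
move=> ->; apply: eq_tsum => c1 x; rewrite tsum_tsum //.
by apply: eq_tsum => c2 c3; rewrite lin2_tens // /G lin2_tens //; lin.
Qed.

Lemma counitlE (C : coalgType k) (U : lmodType k) (F : C -> U) (c : C) :
  lin F -> \tsum_(c1 ⊗ c2 <- comul c) counit c1 *: F c2 = F c.
Proof.
move=> FL; rewrite -[in RHS](counitl c) (lin_tsum _ _ FL).
by apply: eq_tsum => c1 c2; rewrite (linZ FL).
Qed.

Lemma counitrE (C : coalgType k) (U : lmodType k) (F : C -> U) (c : C) :
  lin F -> \tsum_(c1 ⊗ c2 <- comul c) counit c2 *: F c1 = F c.
Proof.
move=> FL; rewrite -[in RHS](counitr c) (lin_tsum _ _ FL).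
by apply: eq_tsum => c1 c2; rewrite (linZ FL).
Qed.

Section Conv.
Variables (C : coalgType k) (R : ualgType k).

(** Associativity of convolution: [f = f * (m * e) = (f * m) * e = r e]. It replaces the usual
    uniqueness of convolution inverses. *)
Lemma convolution_div (f m e : C -> R) (r : R) : lin f -> lin m -> lin e ->
  (forall c, \tsum_(c1 ⊗ c2 <- comul c) f c1 * m c2 = counit c *: r) ->
  (forall c, \tsum_(c1 ⊗ c2 <- comul c) m c1 * e c2 = counit c *: (1 : R)) ->
  forall c, f c = r * e c.
Proof.
move=> fL mL eL fm me c.
transitivity (\tsum_(c1 ⊗ x <- comul c) \tsum_(c2 ⊗ c3 <- comul x)
  (f c1 * m c2 * e c3)).
  rewrite -(counitrE c fL); apply: eq_tsum => c1 x.
  have := congr1 (fun y => f c1 * y) (me x).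
  rewrite (lin_tsum _ _ (lin_mulr _ (@lin_id _ _))) -ualg_scalerAr mulr1 => <-.
  by apply: eq_tsum => ? ? /=; rewrite mulrA.
rewrite -comulA3; last first.
  by split=> ? ?; [do 2!apply: lin_mull|apply: lin_mull; apply: lin_mulr
                  |apply: lin_mulr].
rewrite -(counitlE c (lin_mulr r eL)); apply: eq_tsum => x c3.
rewrite ualg_scalerAl -fm.
by rewrite (lin_tsum _ _ (lin_mull (e c3) (@lin_id _ _))).
Qed.
End Conv.
End Sweedler.

(** * The antipode as an anti-homomorphism of algebras and of coalgebras *)

Section HopfIdentities.
Variables (k : fieldType) (H : hopfAlgType k) (U : lmodType k).
Implicit Types (g h : H).
Local Notation S := (antipode : H -> H).

Lemma comul1 : comul (1 : H) = (1 : H) ⊗ (1 : H).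
Proof. by have [-> _] := @comul_monoid_morphism k H. Qed.

Lemma counit1 : counit (1 : H) = 1.
Proof. by have [-> _] := @counit_monoid_morphism k H. Qed.

Lemma counitM g h : counit (g * h) = counit g * counit h.
Proof. by have [_ ->] := @counit_monoid_morphism k H. Qed.

Lemma comulME (F : H -> H -> U) g h : lin2 F ->
  \tsum_(x ⊗ y <- comul (g * h)) F x y =
  \tsum_(g1 ⊗ g2 <- comul g) \tsum_(h1 ⊗ h2 <- comul h) F (g1 * h1) (g2 * h2).
Proof.
move=> FL; have [_ ->] := @comul_monoid_morphism k H.
rewrite [_ * _]/(tens_mul _ _) /tens_mul tsum_tsum //; apply: eq_tsum => g1 g2.
rewrite tsum_tsum //; apply: eq_tsum => h1 h2; exact: lin2_tens.
Qed.

Lemma antipodelE (F : H -> U) h : lin F ->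
  \tsum_(h1 ⊗ h2 <- comul h) F (S h1 * h2) = counit h *: F 1.
Proof.
by move=> FL; rewrite -(lin_tsum _ _ FL) (proj1 (antipodeP h)) (linZ FL).
Qed.

Lemma antipoderE (F : H -> U) h : lin F ->
  \tsum_(h1 ⊗ h2 <- comul h) F (h1 * S h2) = counit h *: F 1.
Proof.
by move=> FL; rewrite -(lin_tsum _ _ FL) (proj2 (antipodeP h)) (linZ FL).
Qed.

Lemma antipode1 : S 1 = 1.
Proof.
have [] := antipodeP (1 : H).
rewrite comul1 counit1 scale1r lin2_tens; last by lin.
by rewrite mulr1.
Qed.

End HopfIdentities.

Section Antipode.
Variables (k : fieldType) (H : hopfAlgType k).
Implicit Types (g h : H).
Local Notation S := (antipode : H -> H).

Lemma counit_antipode h : counit (S h) = counit h.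
Proof.
have /= := @antipodelE k H k^o (fun x => counit x : k^o) h _.
rewrite counit1 => /(_ _)/wrap[|e]; first by lin.
transitivity (counit h *: (1 : k^o)); last exact: mulr1.
rewrite -e -(counitrE (U := k^o) (F := fun x => counit (S x)) h); last by lin.
by apply: (@eq_tsum _ _ _ k^o) => h1 h2 /=; rewrite counitM mulrC.
Qed.

Lemma antipodeM g h : S (g * h) = S h * S g.
Proof.
(* The two factors are split off one at a time: convolution in [y] proves this identity, and
   convolution in [g] then uses it with [r = S h]. *)
have step (x y : H) :
    \tsum_(x1 ⊗ x2 <- comul x) S (x1 * y) * x2 = counit x *: S y.
  have -> : counit x *: S y = (counit x *: (1 : H)) * S y.
    by rewrite -ualg_scalerAl mul1r.
  move: y; apply: (@convolution_div _ _ _ _ id) => [|||y|y]; try by lin.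
    transitivity (\tsum_(z1 ⊗ z2 <- comul (x * y)) S z1 * z2).
      rewrite comulME; last by lin.
      rewrite exchange_tsum; apply: eq_tsum => y1 y2.
      rewrite (lin_tsum _ _ (lin_mull y2 (@lin_id _ _))).
      by apply: eq_tsum => ? ? /=; rewrite mulrA.
    by rewrite (proj1 (antipodeP _)) counitM scalerA mulrC.
  exact: (proj2 (antipodeP _)).
move: g; apply: (@convolution_div _ _ _ (fun g => S (g * h)) id);
  [lin|lin|lin|move=> g; exact: step|move=> g; exact: (proj2 (antipodeP _))].
Qed.

(** In the convolution algebra of maps from [H] to [H ⊗ H], the left side is a left inverse of
    [comul] and the right side a right inverse. *)
Lemma comul_antipode h :
  comul (S h) = \tsum_(h1 ⊗ h2 <- comul h) S h2 ⊗ S h1.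
Proof.
rewrite -[RHS]mul1r; move: h.
apply: (@convolution_div _ _ _ (fun h => comul (S h)) comul
  (fun h => \tsum_(h1 ⊗ h2 <- comul h) S h2 ⊗ S h1)) => [|||h|h]; try by lin.
  have [c1 cM] := @comul_monoid_morphism k H.
  under eq_tsum do rewrite -cM.
  rewrite antipodelE; last by lin.
  by rewrite c1.
transitivity (\tsum_(x ⊗ y <- comul h) \tsum_(h1 ⊗ h2 <- comul x)
   \tsum_(h3 ⊗ h4 <- comul y) (h1 * S h4) ⊗ (h2 * S h3)).
  apply: eq_tsum => x y; rewrite {1}[comul x]tsum_tensE.
  rewrite (lin_tsum _ _ (lin_mull _ (@lin_id _ _))).
  apply: eq_tsum => h1 h2 /=; rewrite (lin_tsum _ _ (lin_mulr _ (@lin_id _ _))).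
  by apply: eq_tsum => h3 h4; rewrite tensM.
rewrite comulA3; last by lin.
transitivity (\tsum_(h1 ⊗ x <- comul h) (h1 * S x) ⊗ (1 : H)).
  apply: eq_tsum => h1 x.
  rewrite -comulA3; last by lin.
  rewrite -(counitlE (F := fun y => (h1 * S y) ⊗ (1 : H))); last by lin.
  by apply: eq_tsum => z h4; rewrite antipoderE; last by lin.
by rewrite (antipoderE (F := fun y => y ⊗ (1 : H))); last by lin.
Qed.
End Antipode.

(** * Identities for the inverse of the antipode *)

Section InverseAntipode.
Variables (k : fieldType) (H : hopfAlgType k).
Hypothesis bijS : bijective (antipode : H -> H).
Implicit Types (g h : H) (U : lmodType k).
Local Notation S := (antipode : H -> H).
Local Notation S' := (@antipodeV k H).

Let SI : injective S := bij_inj bijS.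

Lemma antipodeV1 : S' 1 = 1.
Proof. by apply: SI; rewrite antipodeVK // antipode1. Qed.

Lemma antipodeVM g h : S' (g * h) = S' h * S' g.
Proof. by apply: SI; rewrite antipodeM !antipodeVK. Qed.

Lemma counit_antipodeV h : counit (S' h) = counit h.
Proof. by rewrite -counit_antipode antipodeVK. Qed.

Lemma comul_antipodeVE U (F : H -> H -> U) h : lin2 F ->
  \tsum_(x ⊗ y <- comul (S' h)) F x y =
  \tsum_(h1 ⊗ h2 <- comul h) F (S' h2) (S' h1).
Proof.
move=> FL; have FL' : lin2 (fun x y => F (S' y) (S' x)).
  by split=> ?; [apply: (lin_fun (FL.2 _)) | apply: (lin_fun (FL.1 _))]; lin.
rewrite -[h in RHS](antipodeVK bijS) comul_antipode tsum_tsum //.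
by apply: eq_tsum => x y; rewrite lin2_tens // !antipodeK.
Qed.

(** This is [S^-1] applied to [S(h_1) h_2 = ε(h)], which reverses the order of the factors. *)
Lemma antipodeVlE U (F : H -> U) h : lin F ->
  \tsum_(h1 ⊗ h2 <- comul h) F (S' h2 * h1) = counit h *: F 1.
Proof.
move=> FL; have FL' : lin (fun x => F (S' x)) by apply: (lin_fun FL); lin.
rewrite -antipodeV1 -(antipodelE h FL').
by apply: eq_tsum => h1 h2; rewrite antipodeVM antipodeK.
Qed.

Lemma antipodeVrE U (F : H -> U) h : lin F ->
  \tsum_(h1 ⊗ h2 <- comul h) F (h2 * S' h1) = counit h *: F 1.
Proof.
move=> FL; have FL' : lin (fun x => F (S' x)) by apply: (lin_fun FL); lin.
rewrite -antipodeV1 -(antipoderE h FL').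
by apply: eq_tsum => h1 h2; rewrite antipodeVM antipodeK.
Qed.

End InverseAntipode.

(** * Coactions in Sweedler form, and the algebra map [Id ⊗ ε] *)

Section Coaction.
Variables (k : fieldType) (H : hopfAlgType k) (A : comodAlgType H).
Implicit Types (a b : A) (U : lmodType k).

Lemma coactA3 U (F : A -> H -> H -> U) a : lin3 F ->
  \tsum_(x ⊗ h2 <- coact a) \tsum_(a0 ⊗ h1 <- coact x) F a0 h1 h2 =
  \tsum_(a0 ⊗ y <- coact a) \tsum_(h1 ⊗ h2 <- comul y) F a0 h1 h2.
Proof.
case=> F1 F2 F3.
pose G (u : A ⊗ H) (h : H) := tsum u (fun a0 h1 => F a0 h1 h).
have GL : lin2 G by rewrite /G; lin.
have /(congr1 (fun t => tsum t G)) := coactA a.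
rewrite !tsum_tsum //.
under eq_tsum do rewrite lin2_tens //.
move=> ->; apply: eq_tsum => a0 y; rewrite tsum_tsum //.
by apply: eq_tsum => h1 h2; rewrite lin2_tens // /G lin2_tens //; lin.
Qed.

Lemma coact_counitE U (F : A -> U) a : lin F ->
  \tsum_(a0 ⊗ a1 <- coact a) counit a1 *: F a0 = F a.
Proof.
move=> FL; rewrite -[in RHS](coact_counit a) (lin_tsum _ _ FL).
by apply: eq_tsum => a0 a1; rewrite (linZ FL).
Qed.

Lemma coactME U (F : A -> H -> U) a b : lin2 F ->
  \tsum_(x ⊗ y <- coact (a * b)) F x y =
  \tsum_(a0 ⊗ a1 <- coact a) \tsum_(b0 ⊗ b1 <- coact b) F (a0 * b0) (a1 * b1).
Proof.
move=> FL; have [_ ->] := @coact_monoid_morphism k H A.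
rewrite [_ * _]/(tens_mul _ _) /tens_mul tsum_tsum //; apply: eq_tsum => a0 a1.
rewrite tsum_tsum //; apply: eq_tsum => b0 b1; exact: lin2_tens.
Qed.

Lemma coact1 : coact (1 : A) = (1 : A) ⊗ (1 : H).
Proof. by have [-> _] := @coact_monoid_morphism k H A. Qed.

Lemma id_counit_lin : lin (@id_counit k H A).
Proof. by rewrite /id_counit; lin. Qed.

Lemma lin_id_counit U (f : U -> (A ⊗ H)%type) :
  lin f -> lin (fun u => id_counit (f u)).
Proof. exact: lin_fun id_counit_lin. Qed.

Lemma id_counit_tens a (h : H) : id_counit (a ⊗ h) = counit h *: a.
Proof. by rewrite /id_counit lin2_tens //; lin. Qed.

Lemma id_counitM (s t : A ⊗ H) : id_counit (s * t) = id_counit s * id_counit t.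
Proof.
rewrite {2}/id_counit (lin_tsum _ _ (lin_mull _ (@lin_id _ _))).
rewrite {1}[s]tsum_tensE (lin_tsum _ _ (lin_mull _ (@lin_id _ _))).
rewrite (lin_tsum _ _ id_counit_lin); apply: eq_tsum => a x /=.
rewrite {1}[t]tsum_tensE (lin_tsum _ _ (lin_mulr _ (@lin_id _ _))).
rewrite (lin_tsum _ _ id_counit_lin) /id_counit.
rewrite (lin_tsum _ _ (lin_mulr _ (@lin_id _ _))).
apply: eq_tsum => b y /=; rewrite tensM -/(id_counit _) id_counit_tens counitM.
by rewrite -ualg_scalerAl -ualg_scalerAr scalerA.
Qed.

End Coaction.

(** * Cancellation of adjacent Sweedler factors *)

Section Cancel.
Variables (k : fieldType) (H : hopfAlgType k) (A : comodAlgType H).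
Hypothesis bijS : bijective (antipode : H -> H).
Implicit Types (h : H) (a : A) (U : lmodType k).
Local Notation S' := (@antipodeV k H).

Lemma antipodeVl_comul U (F : H -> H -> U) h : lin2 F ->
  \tsum_(h1 ⊗ x <- comul h) \tsum_(h2 ⊗ h3 <- comul x) F (S' h2 * h1) h3 =
  F 1 h.
Proof.
case=> F1 F2.
rewrite -(comulA3 (F := fun h1 h2 h3 => F (S' h2 * h1) h3)); last first.
  by split=> ? ?; [apply: (lin_fun (F1 _))|apply: (lin_fun (F1 _))|]; lin.
rewrite -(counitlE h (F2 1)); apply: eq_tsum => x h3.
exact: (antipodeVlE bijS (F := F^~ h3)).
Qed.

Lemma antipodeVr_comul U (F : H -> H -> U) h : lin2 F ->
  \tsum_(h1 ⊗ x <- comul h) \tsum_(h2 ⊗ h3 <- comul x) F (h2 * S' h1) h3 =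
  F 1 h.
Proof.
case=> F1 F2.
rewrite -(comulA3 (F := fun h1 h2 h3 => F (h2 * S' h1) h3)); last first.
  by split=> ? ?; [apply: (lin_fun (F1 _))|apply: (lin_fun (F1 _))|]; lin.
rewrite -(counitlE h (F2 1)); apply: eq_tsum => x h3.
exact: (antipodeVrE bijS (F := F^~ h3)).
Qed.

Lemma antipodeVr_coact U (F : A -> H -> U) a : lin2 F ->
  \tsum_(a0 ⊗ x <- coact a) \tsum_(a1 ⊗ a2 <- comul x) F a0 (a2 * S' a1) =
  F a 1.
Proof.
case=> F1 F2; rewrite -(coact_counitE a (F1 1)); apply: eq_tsum => a0 x.
exact: (antipodeVrE bijS (F := F a0)).
Qed.

End Cancel.

(** * The calculus of [twist] *)

Section TwistDefinition.
Variables (k : fieldType) (H : hopfAlgType k) (A : comodAlgType H).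
Implicit Types (x y : H) (z : A).
Local Notation S' := (@antipodeV k H).

Definition twist z y x : A ⊗ H :=
  \tsum_(z0 ⊗ z1 <- coact z) z0 ⊗ (y * S' (x * z1)).

Lemma lin_twist1 (U : lmodType k) (f : U -> A) y x :
  bijective (antipode : H -> H) -> lin f -> lin (fun u => twist (f u) y x).
Proof. by move=> *; rewrite /twist; lin. Qed.

Lemma lin_twist2 (U : lmodType k) (f : U -> H) z x :
  bijective (antipode : H -> H) -> lin f -> lin (fun u => twist z (f u) x).
Proof. by move=> *; rewrite /twist; lin. Qed.

Lemma lin_twist3 (U : lmodType k) (f : U -> H) z y :
  bijective (antipode : H -> H) -> lin f -> lin (fun u => twist z y (f u)).
Proof. by move=> *; rewrite /twist; lin. Qed.

End TwistDefinition.

Ltac lin_hook ::=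
  lazymatch goal with
  | |- lin (fun u => id_counit (@?f u)) => apply: lin_id_counit
  | |- lin (fun u => twist (@?f u) (@?g u) (@?h u)) =>
    lazymatch g with
    | fun _ => ?y =>
      lazymatch h with
      | fun _ => ?x => apply: lin_twist1
      | _ => apply: lin_twist3
      end
    | _ => apply: lin_twist2
    end
  end.

Section Twist.
Variables (k : fieldType) (H : hopfAlgType k) (A : comodAlgType H).
Hypothesis bijS : bijective (antipode : H -> H).
Implicit Types (g h x y : H) (a b z : A).
Local Notation S' := (@antipodeV k H).

Lemma mul_coact_twist a z y x :
  \tsum_(a0 ⊗ a1 <- coact a) (a0 ⊗ (1 : H)) * twist z y (x * a1) =
  twist (a * z) y x.
Proof.
rewrite [RHS]coactME; last by lin.
apply: eq_tsum => a0 a1; rewrite (lin_tsum _ _ (lin_mulr _ (@lin_id _ _))).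
by apply: eq_tsum => z0 z1 /=; rewrite tensM mul1r !mulrA.
Qed.

(** By anti-multiplicativity [y a_2 S^-1(x z_1 a_1) = y a_2 S^-1(a_1) S^-1(x z_1)], and the two
    factors from [a] cancel. *)
Lemma twist_coact_mul a z y x :
  \tsum_(a0 ⊗ a1 <- coact a) twist (z * a0) (y * a1) x =
  twist z y x * (a ⊗ (1 : H)).
Proof.
rewrite (lin_tsum _ _ (lin_mull _ (@lin_id _ _))).
transitivity (\tsum_(b ⊗ a2 <- coact a) \tsum_(z0 ⊗ z1 <- coact z)
   \tsum_(a0 ⊗ a1 <- coact b) (z0 * a0) ⊗ (y * (a2 * S' a1) * S' (x * z1))).
  apply: eq_tsum => b a2; rewrite /twist coactME; last by lin.
  apply: eq_tsum => z0 z1; apply: eq_tsum => a0 a1.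
  by rewrite mulrA (antipodeVM bijS (x * z1)) !mulrA.
rewrite exchange_tsum; apply: eq_tsum => z0 z1 /=.
rewrite (coactA3 (A := A) (F := fun (a0 : A) (a1 a2 : H) =>
   (z0 * a0) ⊗ (y * (a2 * S' a1) * S' (x * z1)))); last by lin.
rewrite (antipodeVr_coact bijS (F := fun (a0 : A) (w : H) =>
   (z0 * a0) ⊗ (y * w * S' (x * z1)))); last by lin.
by rewrite tensM !mulr1.
Qed.

Lemma twist_comul_mul g z y x :
  \tsum_(g1 ⊗ g2 <- comul g) twist z y (g2 * x) * ((1 : A) ⊗ g1) =
  counit g *: twist z y x.
Proof.
rewrite (lin_tsum _ _ (lin_scaler _ (@lin_id _ _))).
transitivity (\tsum_(g1 ⊗ g2 <- comul g) \tsum_(z0 ⊗ z1 <- coact z)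
   z0 ⊗ (y * S' (x * z1) * (S' g2 * g1))).
  apply: eq_tsum => g1 g2; rewrite (lin_tsum _ _ (lin_mull _ (@lin_id _ _))).
  apply: eq_tsum => z0 z1 /=; rewrite tensM mulr1 -(mulrA g2).
  by rewrite (antipodeVM bijS g2) !mulrA.
rewrite exchange_tsum; apply: eq_tsum => z0 z1.
rewrite (antipodeVlE bijS (F := fun w => z0 ⊗ (y * S' (x * z1) * w)));
  last by lin.
by rewrite mulr1.
Qed.

Lemma mul_twist g z y x : ((1 : A) ⊗ g) * twist z y x = twist z (g * y) x.
Proof.
rewrite (lin_tsum _ _ (lin_mulr _ (@lin_id _ _))).
by apply: eq_tsum => z0 z1 /=; rewrite tensM mul1r mulrA.
Qed.

(* The left-hand side of the second Casimir condition and of the first        *)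
(* integral condition, with [t] in the place of the value of [B] or [T].      *)
Definition coact_comul (t : A ⊗ H) h : (A ⊗ H)%type ⊗ H :=
  \tsum_(b ⊗ v <- t) \tsum_(b0 ⊗ b1 <- coact b) \tsum_(v1 ⊗ v2 <- comul v)
    (b0 ⊗ v1) ⊗ (v2 * h * b1).

Lemma coact_comul_lin h : lin (coact_comul^~ h).
Proof. by rewrite /coact_comul; lin. Qed.

(** The last tensor factor is [y_2 S^-1(x_2 z_2) x_1 z_1]. The reversal by [S^-1] brings [S^-1(x_2)]
    next to [x_1]; once these cancel, [S^-1(z_2)] meets [z_1]. *)
Lemma coact_comul_twist z y x :
  \tsum_(x1 ⊗ x2 <- comul x) coact_comul (twist z y x2) x1 =
  \tsum_(y1 ⊗ y2 <- comul y) twist z y1 x ⊗ y2.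
Proof.
transitivity (\tsum_(x1 ⊗ w <- comul x) \tsum_(z0 ⊗ u <- coact z)
  \tsum_(z1 ⊗ v <- comul u) \tsum_(y1 ⊗ y2 <- comul y)
  \tsum_(x2 ⊗ x3 <- comul w) \tsum_(z2 ⊗ z3 <- comul v)
    (z0 ⊗ (y1 * S' (x3 * z3))) ⊗ (y2 * S' (x2 * z2) * x1 * z1)).
  apply: eq_tsum => x1 w; rewrite /coact_comul tsum_tsum; last by lin.
  rewrite -coactA3; last by lin.
  apply: eq_tsum => b v; rewrite lin2_tens; last by lin.
  apply: eq_tsum => z0 z1; rewrite comulME; last by lin.
  apply: eq_tsum => y1 y2; rewrite comul_antipodeVE //; last by lin.
  by rewrite comulME; last by lin.
transitivity (\tsum_(x1 ⊗ w <- comul x) \tsum_(x2 ⊗ x3 <- comul w)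
  \tsum_(z0 ⊗ u <- coact z) \tsum_(z1 ⊗ v <- comul u)
  \tsum_(y1 ⊗ y2 <- comul y) \tsum_(z2 ⊗ z3 <- comul v)
    (z0 ⊗ (y1 * S' (x3 * z3))) ⊗ (y2 * (S' z2 * (S' x2 * x1) * z1))).
  apply: eq_tsum => x1 w; symmetry.
  rewrite exchange_tsum; apply: eq_tsum => z0 u.
  rewrite exchange_tsum; apply: eq_tsum => z1 v.
  rewrite exchange_tsum; apply: eq_tsum => y1 y2.
  apply: eq_tsum => x2 x3; apply: eq_tsum => z2 z3.
  by rewrite (antipodeVM bijS x2) !mulrA.
rewrite (antipodeVl_comul bijS (F := fun w x3 : H => \tsum_(z0 ⊗ u <- coact z)
  \tsum_(z1 ⊗ v <- comul u) \tsum_(y1 ⊗ y2 <- comul y)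
  \tsum_(z2 ⊗ z3 <- comul v)
    (z0 ⊗ (y1 * S' (x3 * z3))) ⊗ (y2 * (S' z2 * w * z1)))); last by lin.
under [RHS]eq_tsum do rewrite (lin_tsum _ _ (lin_tensl _ (@lin_id _ _))).
rewrite [RHS]exchange_tsum; apply: eq_tsum => z0 u.
rewrite exchange_tsum; apply: eq_tsum => y1 y2.
rewrite -[y2 in RHS]mulr1 -(antipodeVl_comul bijS (F := fun w z3 : H =>
  (z0 ⊗ (y1 * S' (x * z3))) ⊗ (y2 * w))); last by lin.
by apply: eq_tsum => z1 v; apply: eq_tsum => z2 z3; rewrite mulr1.
Qed.

(** The opposite product in [H] puts [S^-1(g_2)] directly before [g_1]. What remains,
    [S^-1(z'_1) S^-1(x z_1)], is [S^-1(x z_1 z'_1)], which belongs to [z * z']. *)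
Lemma twist_mul_op z z' y x g :
  \tsum_(g1 ⊗ g2 <- comul g)
  \tsum_(b ⊗ v <- twist z g1 x) \tsum_(c ⊗ w <- twist z' y g2)
    (b * c) ⊗ (w * v) = counit g *: twist (z * z') y x.
Proof.
transitivity (\tsum_(z0 ⊗ z1 <- coact z) \tsum_(t0 ⊗ t1 <- coact z')
  \tsum_(g1 ⊗ g2 <- comul g)
   (z0 * t0) ⊗ (y * S' t1 * (S' g2 * g1) * S' (x * z1))).
  under [RHS]eq_tsum do rewrite exchange_tsum.
  rewrite [RHS]exchange_tsum; apply: eq_tsum => g1 g2.
  rewrite tsum_tsum; last by lin.
  apply: eq_tsum => z0 z1; rewrite lin2_tens; last by lin.
  rewrite tsum_tsum; last by lin.
  apply: eq_tsum => t0 t1; rewrite lin2_tens; last by lin.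
  by rewrite (antipodeVM bijS g2) !mulrA.
rewrite [twist (z * z') y x]coactME; last by lin.
rewrite (lin_tsum _ _ (lin_scaler _ (@lin_id _ _))).
apply: eq_tsum => z0 z1; rewrite (lin_tsum _ _ (lin_scaler _ (@lin_id _ _))).
apply: eq_tsum => t0 t1 /=; rewrite (antipodeVlE bijS (F := fun w =>
  (z0 * t0) ⊗ (y * S' t1 * w * S' (x * z1)))); last by lin.
by rewrite mulr1 (mulrA x) (antipodeVM bijS (x * z1)) mulrA.
Qed.

(** What is left of [coact_comul] after [Id ⊗ ε] on its first factor; [twist] undoes it up to a
    right multiplication. *)
Definition cotwist (t : A ⊗ H) h : A ⊗ H :=
  \tsum_(b ⊗ v <- t) \tsum_(b0 ⊗ b1 <- coact b) b0 ⊗ (v * h * b1).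

Lemma coact_comul_counit t h :
  \tsum_(s ⊗ w <- coact_comul t h) id_counit s ⊗ w = cotwist t h.
Proof.
have L : lin2 (fun (s : A ⊗ H) (w : H) => id_counit s ⊗ w).
  by split=> ?; [apply/lin_tensl/id_counit_lin | lin].
rewrite tsum_tsum //; apply: eq_tsum => b v.
rewrite tsum_tsum //; apply: eq_tsum => b0 b1.
rewrite tsum_tsum //.
rewrite -(counitlE (F := fun v : H => b0 ⊗ (v * h * b1))); last by lin.
apply: eq_tsum => v1 v2; rewrite lin2_tens // id_counit_tens.
by rewrite tensZl.
Qed.

Lemma twist_cotwist t x y :
  \tsum_(b ⊗ v <- cotwist t y) twist b v x = t * ((1 : A) ⊗ (y * S' x)).
Proof.
rewrite tsum_tsum; last by lin.
rewrite [t in RHS]tsum_tensE (lin_tsum _ _ (lin_mull _ (@lin_id _ _))).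
apply: eq_tsum => b v /=; rewrite tsum_tsum; last by lin.
transitivity (\tsum_(c ⊗ b2 <- coact b) \tsum_(b0 ⊗ b1 <- coact c)
   b0 ⊗ (v * y * (b2 * S' b1) * S' x)).
  apply: eq_tsum => c b2; rewrite lin2_tens; last by lin.
  by apply: eq_tsum => b0 b1; rewrite (antipodeVM bijS x) !mulrA.
rewrite coactA3; last by lin.
rewrite (antipodeVr_coact bijS (F := fun (b0 : A) w =>
  b0 ⊗ (v * y * w * S' x))); last by lin.
by rewrite tensM !mulr1 mulrA.
Qed.

(** By [twist_cotwist] the right side is the sum of [X h_3 * (1 ⊗ h_2 S^-1(h_1))], which collapses
    to [X h]. *)
Lemma cotwist_inv (X Y : H -> A ⊗ H) : lin X ->
  (forall h, \tsum_(h1 ⊗ h2 <- comul h) cotwist (X h2) h1 = Y h) ->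
  forall h, X h =
    \tsum_(h1 ⊗ h2 <- comul h) \tsum_(b ⊗ v <- Y h2) twist b v h1.
Proof.
move=> XL XY h.
have L : lin2 (fun w u => X u * ((1 : A) ⊗ w)).
  by split=> ?; [lin | apply: lin_mull].
transitivity (X h * ((1 : A) ⊗ (1 : H))); first by rewrite tens1 mulr1.
rewrite -(antipodeVr_comul bijS h L); apply: eq_tsum => h1 u.
rewrite -XY tsum_tsum; last by lin.
by apply: eq_tsum => h2 h3; rewrite twist_cotwist.
Qed.

End Twist.

(** * Extensionality and construction of bundled linear maps *)

Section LinearMaps.
Variable k : fieldType.
Implicit Types U V W : lmodType k.

Lemma linear_ext U V (f g : {linear U -> V}) : f =1 g -> f = g.
Proof.
move=> /funext; case: f g => f [[f0] [fS]] [g [[g0] [gS]]] /= fg.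
case: _ / fg in g0 gS *.
by rewrite (Prop_irrelevance f0 g0) (Prop_irrelevance fS gS).
Qed.

Lemma lin_exists U V (f : U -> V) : lin f -> exists g : {linear U -> V}, g =1 f.
Proof.
move=> fL; pose m := GRing.isLinear.Build k U V _ f fL.
pose g : {linear U -> V} := HB.pack f m.
by exists g.
Qed.

Lemma lin2_exists U V W (F : U -> V -> W) : lin2 F ->
  exists g : {linear (U ⊗ V)%type -> W}, forall u v, g (u ⊗ v) = F u v.
Proof.
move=> FL; have [g gE] := lin_exists (lin_tsuml FL (@lin_id _ _)).
by exists g => u v; rewrite gE lin2_tens.
Qed.

Lemma linear_tens_ext U V W (f g : {linear (U ⊗ V)%type -> W}) :
  (forall u v, f (u ⊗ v) = g (u ⊗ v)) -> f = g.
Proof. by move=> fg; apply/linear_ext/eq_linear_tens. Qed.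

End LinearMaps.

(** * From a Casimir morphism to its integral *)

Section FromCasimir.
Variables (k : fieldType) (H : hopfAlgType k) (A : comodAlgType H).
Hypothesis bijS : bijective (antipode : H -> H).
Variable B : {linear (H ⊗ H)%type -> (A ⊗ H)%type}.
Implicit Types (a : A) (g h : H).
Local Notation S' := (@antipodeV k H).

Lemma casimir_integral : is_casimir B -> is_integral (Phi B).
Proof.
case=> B1 B2; split=> [h|a h].
  rewrite B2 comul1 lin2_tens //; lin.
(* The first Casimir condition is used with [g = S^-1(a_1)]. As [S^-1] reverses the
   comultiplication, the second argument of [B] becomes [S^-1(a_3) a_2], which cancels to 1. *)
under [RHS]eq_tsum do rewrite -[Phi _ _]/(B _) -B1.
rewrite coactA3; last by lin.
apply: eq_tsum => a0 w; rewrite comulA3; last by lin.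
apply: eq_tsum => a1 v; symmetry.
transitivity (\tsum_(a2 ⊗ y <- comul v) \tsum_(u ⊗ y3 <- comul y)
   \tsum_(y1 ⊗ y2 <- comul u) (a0 ⊗ (1 : H)) *
     B ((S' y2 * h * a1) ⊗ (S' y1 * a2)) * ((1 : A) ⊗ S' y3)).
  apply: eq_tsum => a2 y; rewrite comul_antipodeVE //; last by lin.
  apply: eq_tsum => u y3; rewrite comul_antipodeVE //; last by lin.
  by apply: eq_tsum => y1 y2; rewrite mulr1.
under eq_tsum do (rewrite comulA3; last by lin).
by rewrite (antipodeVl_comul bijS (F := fun p u : H =>
  \tsum_(y2 ⊗ y3 <- comul u)
  (a0 ⊗ (1 : H)) * B ((S' y2 * h * a1) ⊗ p) * ((1 : A) ⊗ S' y3))); last by lin.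
Qed.

(* This is the first Casimir condition for [a = 1]. *)
Lemma casimir_counit : is_casimir B -> forall h g,
  id_counit (B (h ⊗ g)) = id_counit (Phi B (S' g * h)).
Proof.
case=> B1 _ h g.
have counit_mul (q x y : H) : \tsum_(q1 ⊗ q2 <- comul q)
    id_counit (B ((q1 * x) ⊗ (q2 * y))) = counit q *: id_counit (B (x ⊗ y)).
  have /(congr1 (@id_counit _ _ _)) := B1 1 q x y.
  rewrite coact1 lin2_tens; last by lin.
  rewrite comul1 lin2_tens; last by lin.
  rewrite !id_counitM !id_counit_tens counit1 scale1r mulr1.
  rewrite -ualg_scalerAl mul1r => <-.
  rewrite (lin_tsum _ _ (@id_counit_lin _ _ _)).
  rewrite -(counitlE (F := fun w : H => \tsum_(q1 ⊗ q2 <- comul w)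
    id_counit (B ((q1 * x) ⊗ (q2 * y))))); last by lin.
  apply: eq_tsum => q1 w; rewrite (lin_tsum _ _ (@id_counit_lin _ _ _)).
  rewrite (lin_tsum _ _ (lin_scaler _ (@lin_id _ _))).
  apply: eq_tsum => q2 q3; rewrite !id_counitM !id_counit_tens counit1 scale1r.
  by rewrite mul1r -ualg_scalerAr !mulr1.
(* Here [h ⊗ g] is rewritten as [g_2 S^-1(g_1) h ⊗ g_3], so that [counit_mul] removes [g_2] and
   [g_3] from both arguments at once. *)
rewrite -[h]mul1r -(antipodeVr_comul bijS (F := fun p g : H =>
  id_counit (B ((p * h) ⊗ g)))); last by lin.
rewrite mul1r -(counitrE (F := fun g : H =>
  id_counit (B ((S' g * h) ⊗ (1 : H))))); last by lin.
apply: eq_tsum => g1 y; rewrite -counit_mul.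
by apply: eq_tsum => g2 g3; rewrite mulr1 mulrA.
Qed.

(** The second Casimir condition, seen through [id_counit], is an equation for [B (h ⊗ g)] with [g]
    fixed, to which [cotwist_inv] applies. The right side mentions only [Phi B]. *)
Lemma casimir_twist : is_casimir B -> forall h g,
  B (h ⊗ g) = \tsum_(h1 ⊗ h2 <- comul h) \tsum_(g1 ⊗ g2 <- comul g)
     twist (id_counit (Phi B (S' g1 * h2))) g2 h1.
Proof.
move=> casB; have [_ B2] := casB; move=> h g.
rewrite (cotwist_inv bijS (X := fun h => B (h ⊗ g))
  (Y := fun h => \tsum_(g1 ⊗ g2 <- comul g) id_counit (B (h ⊗ g1)) ⊗ g2));
  first last.
- move=> {}h; have := B2 h g; rewrite -/(coact_comul _ _).
  move/(congr1 (fun t => tsum t (fun s w => id_counit s ⊗ w))).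
  rewrite !tsum_tsum; try by lin.
  under eq_tsum do rewrite -/(coact_comul _ _) coact_comul_counit.
  by move=> ->; apply: eq_tsum => g1 g2; rewrite lin2_tens //; lin.
- by lin.
apply: eq_tsum => h1 h2; rewrite tsum_tsum; last by lin.
apply: eq_tsum => g1 g2; rewrite lin2_tens; last by lin.
by rewrite casimir_counit.
Qed.

End FromCasimir.

(** * What an integral retains under [Id ⊗ ε] *)

Section FromIntegral.
Variables (k : fieldType) (H : hopfAlgType k) (A : comodAlgType H).
Hypothesis bijS : bijective (antipode : H -> H).
Variable T : {linear H -> (A ⊗ H)%type}.
Hypothesis intT : is_integral T.
Implicit Types (a : A) (g h : H).
Local Notation S' := (@antipodeV k H).

Lemma integral_twist h :
  T h = \tsum_(h1 ⊗ h2 <- comul h) twist (id_counit (T h2)) 1 h1.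
Proof.
rewrite (cotwist_inv bijS (X := T) (Y := fun h => id_counit (T h) ⊗ (1 : H)));
  first last.
- move=> {}h; have := intT.1 h.
  move/(congr1 (fun t => tsum t (fun s w => id_counit s ⊗ w))).
  rewrite !tsum_tsum ?lin2_tens; try by lin.
  by under eq_tsum do rewrite -/(coact_comul _ _) coact_comul_counit.
- by lin.
by apply: eq_tsum => h1 h2; rewrite lin2_tens; last by lin.
Qed.

(** The image of the second integral condition under [id_counit]: the outer factors [S^-1(a_3)] and
    [S^-1(a_1)] are absorbed by the counit. *)
Lemma integral_coact a h :
  \tsum_(a0 ⊗ x <- coact a) \tsum_(a1 ⊗ a2 <- comul x)
    a0 * id_counit (T (S' a2 * h * a1)) = id_counit (T h) * a.
Proof.
have /(congr1 (@id_counit _ _ _)) := intT.2 a h.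
rewrite !(lin_tsum _ _ (@id_counit_lin _ _ _)).
have -> : \tsum_(a0 ⊗ a1 <- coact a)
    id_counit (((1 : A) ⊗ S' a1) * T h * (a0 ⊗ (1 : H))) = id_counit (T h) * a.
  rewrite -(coact_counitE (F := fun a : A => id_counit (T h) * a)); last by lin.
  apply: eq_tsum => a0 a1; rewrite !id_counitM !id_counit_tens.
rewrite counit_antipodeV //.
  by rewrite counit1 scale1r -ualg_scalerAl mul1r ualg_scalerAl.
move<-; apply: eq_tsum => a0 x; rewrite (lin_tsum _ _ (@id_counit_lin _ _ _)).
apply: eq_tsum => a1 y; rewrite (lin_tsum _ _ (@id_counit_lin _ _ _)).
rewrite -(counitrE (F := fun y : H => a0 * id_counit (T (S' y * h * a1))));
  last by lin.
apply: eq_tsum => a2 a3; rewrite !id_counitM !id_counit_tens.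
rewrite counit_antipodeV //.
by rewrite counit1 scale1r -ualg_scalerAr mulr1.
Qed.

End FromIntegral.

(** * From [t] back to a Casimir morphism *)

Section ToCasimir.
Variables (k : fieldType) (H : hopfAlgType k) (A : comodAlgType H).
Hypothesis bijS : bijective (antipode : H -> H).
Local Notation S' := (@antipodeV k H).
Variables (t : {linear H -> A}) (B : {linear (H ⊗ H)%type -> (A ⊗ H)%type}).
Hypothesis BE : forall h p, B (h ⊗ p) =
  \tsum_(h1 ⊗ h2 <- comul h) \tsum_(p1 ⊗ p2 <- comul p)
    twist (t (S' p1 * h2)) p2 h1.
Implicit Types (a : A) (g h p : H).

Lemma twist_casimir2 h p :
  \tsum_(h1 ⊗ h2 <- comul h) coact_comul (B (h2 ⊗ p)) h1 =
  \tsum_(p1 ⊗ p2 <- comul p) B (h ⊗ p1) ⊗ p2.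
Proof.
transitivity (\tsum_(p1 ⊗ p' <- comul p) \tsum_(h1 ⊗ x <- comul h)
  \tsum_(h2 ⊗ h3 <- comul x) coact_comul (twist (t (S' p1 * h3)) p' h2) h1).
  rewrite exchange_tsum; apply: eq_tsum => h1 x.
  rewrite exchange_tsum BE (lin_tsum _ _ (coact_comul_lin h1)).
  apply: eq_tsum => h2 h3; exact: (lin_tsum _ _ (coact_comul_lin h1)).
transitivity (\tsum_(p1 ⊗ p' <- comul p) \tsum_(p2 ⊗ p3 <- comul p')
  \tsum_(x ⊗ h3 <- comul h) twist (t (S' p1 * h3)) p2 x ⊗ p3).
  apply: eq_tsum => p1 p'; rewrite -comulA3; last first.
    by split=> ? ?; rewrite /coact_comul; lin.
  rewrite [RHS]exchange_tsum; apply: eq_tsum => x h3.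
  exact: coact_comul_twist.
rewrite -comulA3; last by lin.
apply: eq_tsum => q p3; rewrite BE (lin_tsum _ _ (lin_tensl _ (@lin_id _ _))).
rewrite exchange_tsum; apply: eq_tsum => x h3.
by rewrite (lin_tsum _ _ (lin_tensl _ (@lin_id _ _))).
Qed.

Lemma twist_casimirM g q h p : B ((g * h) ⊗ (q * p)) =
  \tsum_(h1 ⊗ h2 <- comul h) \tsum_(p1 ⊗ p2 <- comul p)
  \tsum_(g1 ⊗ g2 <- comul g) \tsum_(q1 ⊗ q2 <- comul q)
    twist (t (S' (q1 * p1) * (g2 * h2))) (q2 * p2) (g1 * h1).
Proof.
rewrite BE comulME; last by lin.
rewrite exchange_tsum; apply: eq_tsum => h1 h2.
rewrite [RHS]exchange_tsum; apply: eq_tsum => g1 g2.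
by rewrite comulME 1?exchange_tsum; last by lin.
Qed.

(** The part of the first Casimir condition that concerns [g]. Inside [t] the two middle components
    of [g] cancel, and [twist_comul_mul] then cancels [g_1] against the component in the third slot
    of [twist]. *)
Lemma twist_casimir1g g h p :
  \tsum_(g1 ⊗ g' <- comul g) \tsum_(g2 ⊗ g3 <- comul g')
     B ((g2 * h) ⊗ (g3 * p)) * ((1 : A) ⊗ g1) =
  ((1 : A) ⊗ g) * B (h ⊗ p).
Proof.
transitivity (\tsum_(h1 ⊗ h2 <- comul h) \tsum_(p1 ⊗ p2 <- comul p)
  \tsum_(g1 ⊗ g' <- comul g) \tsum_(g2 ⊗ g3 <- comul g')
  \tsum_(x1 ⊗ x2 <- comul g2) \tsum_(y1 ⊗ y2 <- comul g3)
    twist (t (S' (y1 * p1) * (x2 * h2))) (y2 * p2) (x1 * h1)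
    * ((1 : A) ⊗ g1)).
  transitivity (\tsum_(g1 ⊗ g' <- comul g) \tsum_(g2 ⊗ g3 <- comul g')
    \tsum_(h1 ⊗ h2 <- comul h) \tsum_(p1 ⊗ p2 <- comul p)
    \tsum_(x1 ⊗ x2 <- comul g2) \tsum_(y1 ⊗ y2 <- comul g3)
      twist (t (S' (y1 * p1) * (x2 * h2))) (y2 * p2) (x1 * h1)
      * ((1 : A) ⊗ g1)).
    apply: eq_tsum => g1 g'; apply: eq_tsum => g2 g3; rewrite twist_casimirM.
    do 4![rewrite (lin_tsum _ _ (lin_mull _ (@lin_id _ _)));
          apply: eq_tsum => ? ? /=].
    by [].
  rewrite [RHS]exchange_tsum.
  under [RHS]eq_tsum do rewrite exchange_tsum.
  rewrite [RHS]exchange_tsum; apply: eq_tsum => g1 g'.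
  rewrite [RHS]exchange_tsum.
  under [RHS]eq_tsum do rewrite exchange_tsum.
  rewrite [RHS]exchange_tsum; apply: eq_tsum => g2 g3.
  by rewrite exchange_tsum.
rewrite BE (lin_tsum _ _ (lin_mulr _ (@lin_id _ _))).
apply: eq_tsum => h1 h2; rewrite (lin_tsum _ _ (lin_mulr _ (@lin_id _ _))).
apply: eq_tsum => p1 p2; rewrite mul_twist /=.
transitivity (\tsum_(g1 ⊗ g' <- comul g) \tsum_(x1 ⊗ y <- comul g')
  \tsum_(x2 ⊗ g3 <- comul y) \tsum_(y1 ⊗ y2 <- comul g3)
    twist (t (S' p1 * (S' y1 * x2) * h2)) (y2 * p2) (x1 * h1)
    * ((1 : A) ⊗ g1)).
  apply: eq_tsum => g1 g'; rewrite -comulA3; last by lin.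
  apply: eq_tsum => g2 g3; apply: eq_tsum => x1 x2; apply: eq_tsum => y1 y2.
  by rewrite (antipodeVM bijS y1) !mulrA.
rewrite -comulA3; last by lin.
pose F c w : A ⊗ H := twist (t (S' p1 * c * h2)) (w * p2) h1.
have FL : lin2 F by rewrite /F; lin.
transitivity (\tsum_(u ⊗ y <- comul g) counit u *: F 1 y); last first.
  by rewrite (counitlE g (FL.2 1)) /F mulr1.
apply: eq_tsum => u y; rewrite -(antipodeVl_comul bijS y FL).
rewrite exchange_tsum (lin_tsum _ _ (lin_scaler _ (@lin_id _ _))).
apply: eq_tsum => x2 g3 /=; rewrite exchange_tsum.
rewrite (lin_tsum _ _ (lin_scaler _ (@lin_id _ _))); apply: eq_tsum => y1 y2 /=.
exact: twist_comul_mul.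
Qed.

Lemma twist_casimirM' g q h p : B ((g * h) ⊗ (q * p)) =
  \tsum_(g1 ⊗ g2 <- comul g) \tsum_(q1 ⊗ q2 <- comul q)
  \tsum_(h1 ⊗ h2 <- comul h) \tsum_(p1 ⊗ p2 <- comul p)
    twist (t (S' (q1 * p1) * (g2 * h2))) (q2 * p2) (g1 * h1).
Proof.
rewrite twist_casimirM; under eq_tsum do rewrite exchange_tsum.
rewrite exchange_tsum; apply: eq_tsum => g1 g2.
by under eq_tsum do rewrite exchange_tsum; rewrite exchange_tsum.
Qed.

Hypothesis tJ : forall a h,
  \tsum_(a0 ⊗ x <- coact a) \tsum_(a1 ⊗ a2 <- comul x)
    a0 * t (S' a2 * h * a1) = t h * a.

(** The part that concerns [a]. Its components are consumed in three stages: [mul_coact_twist] moves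
    [a_0] into [twist], [tJ] takes the two components inside [t], and [twist_coact_mul] takes the
    last one. *)
Lemma twist_casimir1a a h p :
  \tsum_(a0 ⊗ a' <- coact a) \tsum_(a1 ⊗ a2 <- comul a')
     (a0 ⊗ (1 : H)) * B ((h * a1) ⊗ (p * a2)) =
  B (h ⊗ p) * (a ⊗ (1 : H)).
Proof.
transitivity (\tsum_(h1 ⊗ h2 <- comul h) \tsum_(p1 ⊗ p2 <- comul p)
  \tsum_(a0 ⊗ a' <- coact a) \tsum_(a1 ⊗ a2 <- comul a')
  \tsum_(u ⊗ v <- comul a1) \tsum_(w ⊗ x <- comul a2)
    (a0 ⊗ (1 : H)) * twist (t (S' (p1 * w) * (h2 * v))) (p2 * x) (h1 * u)).
  transitivity (\tsum_(a0 ⊗ a' <- coact a) \tsum_(a1 ⊗ a2 <- comul a')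
    \tsum_(h1 ⊗ h2 <- comul h) \tsum_(p1 ⊗ p2 <- comul p)
    \tsum_(u ⊗ v <- comul a1) \tsum_(w ⊗ x <- comul a2)
      (a0 ⊗ (1 : H)) * twist (t (S' (p1 * w) * (h2 * v))) (p2 * x) (h1 * u)).
    apply: eq_tsum => a0 a'; apply: eq_tsum => a1 a2; rewrite twist_casimirM'.
    do 4![rewrite (lin_tsum _ _ (lin_mulr _ (@lin_id _ _)));
          apply: eq_tsum => ? ? /=].
    by [].
  rewrite [RHS]exchange_tsum.
  under [RHS]eq_tsum do rewrite exchange_tsum.
  rewrite [RHS]exchange_tsum; apply: eq_tsum => a0 a'.
  rewrite [RHS]exchange_tsum.
  under [RHS]eq_tsum do rewrite exchange_tsum.
  rewrite [RHS]exchange_tsum; apply: eq_tsum => a1 a2.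
  by rewrite exchange_tsum.
rewrite BE (lin_tsum _ _ (lin_mull _ (@lin_id _ _))).
apply: eq_tsum => h1 h2; rewrite (lin_tsum _ _ (lin_mull _ (@lin_id _ _))).
apply: eq_tsum => p1 p2 /=.
transitivity (\tsum_(a0 ⊗ a' <- coact a) \tsum_(u ⊗ y <- comul a')
  \tsum_(v ⊗ a2 <- comul y) \tsum_(w ⊗ x <- comul a2)
    (a0 ⊗ (1 : H)) * twist (t (S' w * (S' p1 * h2) * v)) (p2 * x) (h1 * u)).
  apply: eq_tsum => a0 a'; rewrite -comulA3; last by lin.
  apply: eq_tsum => a1 a2; apply: eq_tsum => u v; apply: eq_tsum => w x.
  by rewrite (antipodeVM bijS p1) !mulrA.
rewrite -coactA3; last by lin.
transitivity (\tsum_(b ⊗ y <- coact a) \tsum_(v ⊗ a2 <- comul y)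
  \tsum_(w ⊗ x <- comul a2)
    twist (b * t (S' w * (S' p1 * h2) * v)) (p2 * x) h1).
  apply: eq_tsum => b y; rewrite exchange_tsum; apply: eq_tsum => v a2.
  by rewrite exchange_tsum; apply: eq_tsum => w x; apply: mul_coact_twist.
transitivity (\tsum_(b ⊗ y <- coact a) \tsum_(y' ⊗ x <- comul y)
  \tsum_(v ⊗ w <- comul y')
    twist (b * t (S' w * (S' p1 * h2) * v)) (p2 * x) h1).
  by apply: eq_tsum => b y; rewrite -comulA3; last by lin.
rewrite -coactA3; last by lin.
rewrite -twist_coact_mul //; apply: eq_tsum => c x.
rewrite -tJ (lin_tsum _ _ (lin_twist1 _ _ bijS (@lin_id _ _))).
apply: eq_tsum => b y'.
by rewrite (lin_tsum _ _ (lin_twist1 _ _ bijS (@lin_id _ _))).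
Qed.

Lemma twist_casimir : is_casimir B.
Proof.
split=> [a g h h'|]; last exact: twist_casimir2.
transitivity (\tsum_(g1 ⊗ g' <- comul g) \tsum_(g2 ⊗ g3 <- comul g')
  \tsum_(a0 ⊗ a' <- coact a) \tsum_(a1 ⊗ a2 <- comul a')
   (a0 ⊗ (1 : H)) * B ((g2 * h * a1) ⊗ (g3 * h' * a2)) * ((1 : A) ⊗ g1)).
  under eq_tsum do rewrite exchange_tsum.
  rewrite exchange_tsum; apply: eq_tsum => g1 g'.
  by under eq_tsum do rewrite exchange_tsum; rewrite exchange_tsum.
rewrite -twist_casimir1g (lin_tsum _ _ (lin_mull _ (@lin_id _ _))).
apply: eq_tsum => g1 g'; rewrite (lin_tsum _ _ (lin_mull _ (@lin_id _ _))).
apply: eq_tsum => g2 g3 /=; rewrite -mulrA.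
(* The two parts combine because the right multiplications by [1 ⊗ g_1] and [a ⊗ 1] commute. *)
have -> : ((1 : A) ⊗ g1) * (a ⊗ (1 : H)) = (a ⊗ (1 : H)) * ((1 : A) ⊗ g1).
  by rewrite !tensM !mulr1 !mul1r.
rewrite mulrA -twist_casimir1a (lin_tsum _ _ (lin_mull _ (@lin_id _ _))).
by apply: eq_tsum => a0 a'; rewrite (lin_tsum _ _ (lin_mull _ (@lin_id _ _))).
Qed.

(** Inside [t] the factor [S^-1(h_3) h_2] cancels, leaving [twist 1 h_2 h_1 = 1 ⊗ h_2 S^-1(h_1)]. *)
Lemma twist_normalized : t 1 = 1 -> normalized_casimir B.
Proof.
move=> t1 h.
transitivity (\tsum_(a ⊗ y <- comul h) \tsum_(b ⊗ w <- comul y)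
  \tsum_(c ⊗ d <- comul w) twist (t (S' c * b)) d a).
  by rewrite -comulA3; [apply: eq_tsum => h1 h2; apply: BE | lin].
rewrite -(antipodeVrE bijS (F := fun w => (1 : A) ⊗ w)); last by lin.
apply: eq_tsum => a y.
rewrite (antipodeVl_comul bijS (F := fun p d => twist (t p) d a)); last by lin.
by rewrite t1 /twist coact1 lin2_tens ?mulr1 //; lin.
Qed.

(** Of the four components of [g], [twist_mul_op] cancels the middle two. The values
    [t(S^-1(g_1) h_2)] and [t(S^-1(l_1) g_4)] then multiply to [t(S^-1(l_1) g_4 S^-1(g_1) h_2)],
    where the outer two cancel. *)
Lemma twist_coseparable :
  (forall g h, t g * t h = t (h * g)) -> h_coseparable B.
Proof.
move=> tM h g l.
pose mop (r s : A ⊗ H) : A ⊗ H :=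
  \tsum_(b ⊗ v <- r) \tsum_(c ⊗ w <- s) (b * c) ⊗ (w * v).
have mopL : lin2 mop by rewrite /mop; lin.
have [mop1 mop2] := mopL.
transitivity (\tsum_(h1 ⊗ h2 <- comul h) \tsum_(l1 ⊗ l2 <- comul l)
  \tsum_(g1 ⊗ g2 <- comul g) \tsum_(p ⊗ q <- comul g1) \tsum_(r ⊗ s <- comul g2)
    mop (twist (t (S' p * h2)) q h1) (twist (t (S' l1 * s)) l2 r)).
  under [RHS]eq_tsum do rewrite exchange_tsum.
  rewrite [RHS]exchange_tsum; apply: eq_tsum => g1 g2.
  rewrite -/(mop _ _) !BE (lin_tsum _ _ (mop1 _)); apply: eq_tsum => h1 h2.
  rewrite [RHS]exchange_tsum (lin_tsum _ _ (mop1 _)); apply: eq_tsum => p q.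
  rewrite [RHS]exchange_tsum (lin_tsum _ _ (mop2 _)); apply: eq_tsum => r s.
  exact: (lin_tsum _ _ (mop2 _)).
rewrite BE (lin_tsum _ _ (lin_scaler _ (@lin_id _ _))).
apply: eq_tsum => h1 h2; rewrite (lin_tsum _ _ (lin_scaler _ (@lin_id _ _))).
apply: eq_tsum => l1 l2 /=.
transitivity (\tsum_(p ⊗ x <- comul g) \tsum_(y ⊗ s <- comul x)
  \tsum_(q ⊗ r <- comul y)
    mop (twist (t (S' p * h2)) q h1) (twist (t (S' l1 * s)) l2 r)).
  rewrite comulA3; last by split=> ? ?; rewrite /mop; lin.
  apply: eq_tsum => p x; rewrite comulA3 //; last first.
  by split=> ? ?; rewrite /mop; lin.
transitivity (\tsum_(p ⊗ s <- comul g)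
    twist (t (S' l1 * (s * S' p) * h2)) l2 h1).
  apply: eq_tsum => p x.
  rewrite -(counitlE (F := fun s : H =>
    twist (t (S' l1 * (s * S' p) * h2)) l2 h1)); last by lin.
  by apply: eq_tsum => y s; rewrite twist_mul_op // tM !mulrA.
rewrite (antipodeVrE bijS
  (F := fun w => twist (t (S' l1 * w * h2)) l2 h1)); last by lin.
by rewrite mulr1.
Qed.

End ToCasimir.

(** * The h-property of [Phi B], and the bijection *)

Lemma id_counit_Phi_antihom (k : fieldType) (H : hopfAlgType k)
    (A : comodAlgType H)
    (B : {linear (H ⊗ H)%type -> (A ⊗ H)%type}) :
  bijective (antipode : H -> H) -> is_casimir B -> h_coseparable B ->
  h_property (Phi B).
Proof.
move=> bijS casB cosB h h'.
(* This is h-coseparability at last argument 1, seen through [id_counit], with [casimir_counit]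
   applied to the first factor. *)
have cos (x y : H) : \tsum_(y1 ⊗ y2 <- comul y)
    id_counit (Phi B (antipodeV y1 * x)) * id_counit (Phi B y2) =
    counit y *: id_counit (Phi B x).
  have /(congr1 (@id_counit _ _ _)) := cosB x y 1.
  rewrite (linZ (@id_counit_lin _ _ _)) => <-.
  rewrite (lin_tsum _ _ (@id_counit_lin _ _ _)); apply: eq_tsum => y1 y2.
  rewrite -casimir_counit // (lin_tsum _ _ (@id_counit_lin _ _ _)).
  rewrite {1}/id_counit (lin_tsum _ _ (lin_mull _ (@lin_id _ _))).
  apply: eq_tsum => b v; rewrite (lin_tsum _ _ (@id_counit_lin _ _ _)).
  rewrite {1}/id_counit (lin_tsum _ _ (lin_mulr _ (@lin_id _ _))).
  apply: eq_tsum => c w /=; rewrite id_counit_tens counitM mulrC.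
  by rewrite -ualg_scalerAl -ualg_scalerAr scalerA.
(* Replacing [h] by [S^-1(h'_2) h'_1 h] and [h'] by [h'_3] brings the product into the form of
   [cos], with [x = h'_1 h]. *)
rewrite id_counitM -[h in LHS]mul1r.
rewrite -(antipodeVl_comul bijS (F := fun p h' : H =>
  id_counit (Phi B (p * h)) * id_counit (Phi B h'))); last by lin.
rewrite -(counitrE (F := fun h' : H => id_counit (Phi B (h' * h))));
  last by lin.
apply: eq_tsum => x y; rewrite -cos.
by apply: eq_tsum => y1 y2; rewrite mulrA.
Qed.

Theorem theorem3p9 (k : fieldType) (H : hopfAlgType k) (A : comodAlgType H)
    (bijS : bijective (antipode : H -> H)) :
  (forall B : {linear (H ⊗ H)%type -> (A ⊗ H)%type},
     is_casimir B -> is_integral (Phi B)) /\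
  set_bij (@Casim_h_norm k H A) (@integral_h_tot k H A) (@Phi k H A).
Proof.
split; first exact: casimir_integral.
split=> [B [casB [normB cosB]]|B C|T [intT [totT hT]]].
- split; first exact: casimir_integral.
  split; last exact: id_counit_Phi_antihom.
  (* Totality is normalization at the grouplike element 1. *)
  have := normB 1; rewrite comul1 lin2_tens; last by lin.
  by rewrite counit1 scale1r.
- rewrite !inE => -[casB _] [casC _] BC; apply: linear_tens_ext => h g.
  by rewrite !casimir_twist // BC.
have [t tE] := lin_exists (lin_id_counit (lin_app T (@lin_id _ _))).
(* The preimage is forced: it is the formula of [casimir_twist] with [t] read off from [T]. *)
have [|B BE] := @lin2_exists k H H (A ⊗ H)%type (fun h p =>
  \tsum_(h1 ⊗ h2 <- comul h) \tsum_(p1 ⊗ p2 <- comul p)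
    twist (t (antipodeV p1 * h2)) p2 h1); first by lin.
exists B; last first.
  apply: linear_ext => h; rewrite [RHS]integral_twist //.
  transitivity (B (h ⊗ (1 : H))) => //; rewrite BE.
  (* At [p = 1] both components of [p] are 1, and each term becomes that of [integral_twist]. *)
  apply: eq_tsum => h1 h2; rewrite comul1 lin2_tens; last by lin.
  by rewrite antipodeV1 // mul1r tE.
split; [apply: (twist_casimir bijS BE)|split].
- move=> a h; rewrite tE -(integral_coact bijS intT).
  by apply: eq_tsum => a0 x; apply: eq_tsum => a1 a2; rewrite tE.
- apply: (twist_normalized bijS BE).
  by rewrite tE totT id_counit_tens counit1 scale1r.
- apply: (twist_coseparable bijS BE) => g h.
  by rewrite !tE -id_counitM hT.
Qed.
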